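(* Let $d \geq 2$. Every polynomial differential operator on $\mathbb{R}^d$ that is equivariant under rigid motions, has total order $\leq 4$ and has polynomial degree $\leq 3$ is a real linear combination of the following 20 operators (each written as its value on a smooth function $f:\mathbb{R}^d\to\mathbb{R}$), which form the library $\mathscr{L}_{\mathrm{MM}}$: $$1;\qquad f,\ \Delta f,\ \Delta^2 f;$$ $$f^2,\ \Delta (f^2),\ \|\nabla f\|^2,\ \Delta^2 (f^2),\ \Delta\|\nabla f\|^2,\ \|\nabla^2 f\|^2,\ (\Delta f)^2;$$ $$f^3,\ \Delta (f^3),\ f\|\nabla f\|^2,\ \Delta^2 (f^3),\ \Delta(f\|\nabla f\|^2),\ f\|\nabla^2 f\|^2,\ f(\Delta f)^2,\ \nabla^2 f(\nabla f,\nabla f),\ \|\nabla f\|^2\Delta f.$$ Moreover, those elements of $\mathscr{L}_{\mathrm{MM}}$ that are not already members of the library $\mathscr{L}_{\mathrm{M}}$ are expressed in terms of $\mathscr{L}_{\mathrm{M}}$ by the following identities, valid for every smooth $f:\mathbb{R}^d\to\mathbb{R}$: \begin{align*} \Delta (f^2) &= 2 f\Delta f + 2\|\nabla f\|^2,\\ \Delta \|\nabla f\|^2 &= 2\langle \nabla\Delta f,\nabla f\rangle + 2\|\nabla^2 f\|^2,\\ \Delta^2 (f^2) &= 2 f\Delta^2 f + 8\langle \nabla\Delta f,\nabla f\rangle + 4\|\nabla^2 f\|^2 + 2(\Delta f)^2,\\ \Delta (f^3) &= 3 f^2\Delta f + 6 f\|\nabla f\|^2,\\ \Delta (f\|\nabla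 f\|^2) &= 2 f\langle \nabla\Delta f,\nabla f\rangle + 2 f\|\nabla^2 f\|^2 + 4\nabla^2 f(\nabla f,\nabla f) + \|\nabla f\|^2\Delta f,\\ \Delta^2 (f^3) &= 3 f^2\Delta^2 f + 24 f\langle \nabla\Delta f,\nabla f\rangle + 12 f\|\nabla^2 f\|^2 + 6 f(\Delta f)^2 + 24\nabla^2 f(\nabla f,\nabla f) + 12\|\nabla f\|^2\Delta f. \end{align*}
   Context: All functions $f:\mathbb{R}^d\to\mathbb{R}$ are smooth. $\nabla f$ is the Euclidean gradient, $\langle\cdot,\cdot\rangle$ the Euclidean inner product, $\|\nabla f\|^2=\langle\nabla f,\nabla f\rangle$, $\nabla^2 f$ is the Hessian, $\|\nabla^2 f\|^2=\sum_{i,j=1}^d(\partial_{x^i}\partial_{x^j}f)^2$, $\nabla^2 f(\nabla f,\nabla f)=\sum_{i,j=1}^d(\partial_{x^i}\partial_{x^j}f)(\partial_{x^i}f)(\partial_{x^j}f)$, $\Delta=\sum_{i=1}^d\partial_{x^i}^2$ is the Laplacian, and $\Delta^2=\Delta\circ\Delta$. Polynomial differential operators: an operator $N$ is a polynomial differential operator if $N(f)$ is a polynomial in $f$ and its iterated partial derivatives, that is, $N$ is a finite sum of operators of the form $P(f)=(L_1f)(L_2f)\cdots(L_nf)$, where each $L_j$ is a linear partial differential operator of order $r_j$. The number $n$ is the polynomial degree of such a product $P$, and $r_1+\cdots+r_n$ is its total order; constant operators $f\mapsto c$ correspond to $n=0$. The operator $N$ has polynomial degree $\leq n$ and total order $\leq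 p$ if it can be written as a finite sum of such products, each having polynomial degree $\leq n$ and total order $\leq p$. Equivariance: a rigid motion of $\mathbb{R}^d$ is a map $T(x)=Ax+b$ with $A\in \mathrm{O}(d)$ an orthogonal matrix and $b\in\mathbb{R}^d$. The operator $N$ is equivariant under rigid motions if $N(f\circ T)=N(f)\circ T$ for every rigid motion $T$ and every smooth $f:\mathbb{R}^d\to\mathbb{R}$. The library $\mathscr{L}_{\mathrm{M}}$ (the multigraph library) consists of the 20 operators $$1;\qquad f,\ \Delta f,\ \Delta^2 f;$$ $$f^2,\ f\Delta f,\ \|\nabla f\|^2,\ f\Delta^2 f,\ \langle\nabla\Delta f,\nabla f\rangle,\ \|\nabla^2 f\|^2,\ (\Delta f)^2;$$ $$f^3,\ f^2\Delta f,\ f\|\nabla f\|^2,\ f^2\Delta^2 f,\ f\langle\nabla\Delta f,\nabla f\rangle,\ f\|\nabla^2 f\|^2,\ f(\Delta f)^2,\ \nabla^2 f(\nabla f,\nabla f),\ \|\nabla f\|^2\Delta f.$$ *)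

(* Defs.v *)
From HB Require Import structures.
From mathcomp Require Import all_boot all_order all_algebra.
From mathcomp Require Import all_classical all_reals all_analysis.

Set Implicit Arguments.
Unset Strict Implicit.
Unset Printing Implicit Defensive.

Import Order.TTheory GRing.Theory Num.Theory.
Import numFieldNormedType.Exports.

Local Open Scope ring_scope.

Section Defs.
Variables (R : realType) (d : nat).

Definition scalar_fun : Type := 'cV[R]_d -> R.

Implicit Types (f g : scalar_fun) (x : 'cV[R]_d).

Definition partial (i : 'I_d) f : scalar_fun :=
  fun x => 'D_(delta_mx i 0) f x.

(* [iter_partial [:: i1; ...; ik] f] is d_{i1} (... (d_{ik} f)). *)
Definition iter_partial (s : seq 'I_d) f : scalar_fun := foldr partial f s.

(* Infinite differentiability: f and all its iterated partial derivatives are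
   (Frechet) differentiable everywhere; equivalently, all iterated partial
   derivatives exist and are continuous. *)
Definition smooth f : Prop :=
  forall (s : seq 'I_d) x, differentiable (iter_partial s f) x.

Definition inner (u v : 'cV[R]_d) : R := \sum_i u i 0 * v i 0.

Definition grad f x : 'cV[R]_d := \col_i partial i f x.

Definition hess f x : 'M[R]_d := \matrix_(i, j) partial i (partial j f) x.

Definition lap f : scalar_fun := fun x => \sum_i partial i (partial i f) x.

Definition bilap f : scalar_fun := lap (lap f).

Definition normsq_grad f : scalar_fun := fun x => inner (grad f x) (grad f x).

Definition normsq_hess f : scalar_fun :=
  fun x => \sum_i \sum_j hess f x i j ^+ 2.

Definition hess_grad_grad f : scalar_fun :=
  fun x => \sum_i \sum_j hess f x i j * grad f x i 0 * grad f x j 0.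

Definition grad_lap_grad f : scalar_fun :=
  fun x => inner (grad (lap f) x) (grad f x).

(* Only the values of an operator on smooth functions are meaningful. *)
Definition operator : Type := scalar_fun -> scalar_fun.

(* Variable smooth coefficients are allowed; constant coefficients are a special
   case. The order is bounded by [r] rather than equal to [r], which makes no
   difference below since only upper bounds on total orders are used. *)
Definition linear_pdo (r : nat) (L : operator) : Prop :=
  exists (m : nat) (a : 'I_m -> scalar_fun) (s : 'I_m -> seq 'I_d),
    (forall k, smooth (a k) /\ (size (s k) <= r)%N) /\
    forall f, smooth f ->
      forall x, L f x = \sum_(k < m) a k x * iter_partial (s k) f x.

(* Polynomial degree [n] and total order [p]. The real factor [c] only matters
   for [n = 0], where it gives the constant operators. *)
Definition product_pdo (n p : nat) (P : operator) : Prop :=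
  exists (c : R) (L : 'I_n -> operator) (r : 'I_n -> nat),
    [/\ forall j, linear_pdo (r j) (L j),
        (\sum_(j < n) r j)%N = p &
        forall f, smooth f -> forall x, P f x = c * \prod_(j < n) L j f x].

Definition polynomial_pdo (n p : nat) (N : operator) : Prop :=
  exists (m : nat) (P : 'I_m -> operator),
    (forall k, exists n' p' : nat,
       [/\ (n' <= n)%N, (p' <= p)%N & product_pdo n' p' (P k)]) /\
    forall f, smooth f -> forall x, N f x = \sum_(k < m) P k f x.

Definition rigid_motion (T : 'cV[R]_d -> 'cV[R]_d) : Prop :=
  exists (A : 'M[R]_d) (b : 'cV[R]_d),
    A *m A^T = 1%:M /\ forall x, T x = A *m x + b.

Definition equivariant (N : operator) : Prop :=
  forall T f, rigid_motion T -> smooth f -> N (f \o T) = N f \o T.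

Definition lib_M : 20.-tuple operator := [tuple
  (fun f x => 1);
  (fun f x => f x);
  (fun f x => lap f x);
  (fun f x => bilap f x);
  (fun f x => f x ^+ 2);
  (fun f x => f x * lap f x);
  (fun f x => normsq_grad f x);
  (fun f x => f x * bilap f x);
  (fun f x => grad_lap_grad f x);
  (fun f x => normsq_hess f x);
  (fun f x => lap f x ^+ 2);
  (fun f x => f x ^+ 3);
  (fun f x => f x ^+ 2 * lap f x);
  (fun f x => f x * normsq_grad f x);
  (fun f x => f x ^+ 2 * bilap f x);
  (fun f x => f x * grad_lap_grad f x);
  (fun f x => f x * normsq_hess f x);
  (fun f x => f x * lap f x ^+ 2);
  (fun f x => hess_grad_grad f x);
  (fun f x => normsq_grad f x * lap f x)].

Definition lib_MM : 20.-tuple operator := [tuple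
  (fun f x => 1);
  (fun f x => f x);
  (fun f x => lap f x);
  (fun f x => bilap f x);
  (fun f x => f x ^+ 2);
  (fun f x => lap (fun y => f y ^+ 2) x);
  (fun f x => normsq_grad f x);
  (fun f x => bilap (fun y => f y ^+ 2) x);
  (fun f x => lap (normsq_grad f) x);
  (fun f x => normsq_hess f x);
  (fun f x => lap f x ^+ 2);
  (fun f x => f x ^+ 3);
  (fun f x => lap (fun y => f y ^+ 3) x);
  (fun f x => f x * normsq_grad f x);
  (fun f x => bilap (fun y => f y ^+ 3) x);
  (fun f x => lap (fun y => f y * normsq_grad f y) x);
  (fun f x => f x * normsq_hess f x);
  (fun f x => f x * lap f x ^+ 2);
  (fun f x => hess_grad_grad f x);
  (fun f x => normsq_grad f x * lap f x)].

End Defs.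

Arguments lib_M R d : clear implicits.
Arguments lib_MM R d : clear implicits.

(* Main.v *)
Require Import Defs.
From HB Require Import structures.
From mathcomp Require Import all_boot all_order all_algebra.
From mathcomp Require Import fingroup perm.
From mathcomp Require Import all_classical all_reals all_analysis.
From mathcomp Require Import ring lra.

(** At a given point, a polynomial differential operator is a polynomial in the
    derivatives of [f] there. Equivariance under translations makes the
    coefficients of this polynomial independent of the point, so the operator is
    decided by a polynomial in the derivatives at the origin. A monomial of it is
    recorded by the word of all its differentiation indices (at most four
    letters) together with the way in which the word is cut into factors (at
    most three); an orthogonal map that permutes the coordinates up to signs acts
    on words letter by letter ([word_mono_precomp]).

    The polynomial equals its own average over the signed permutations of the
    coordinates. Averaging over signs kills the words in which some letter occurs
    an odd number of times; averaging over permutations turns the others into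
    combinations of double sums over two indices [a], [b], placed according to a
    pairing of the positions, and of one more term, the diagonal sum over the
    words [a a a a] ([word_average]). The diagonal sum is invariant under signed
    permutations but not under rotations. It is removed by testing the operator
    on ridge functions [x |-> f ((u . x) e_i)] with [u] a unit vector: double
    sums do not see which unit vector [u] is, while the diagonal sum is
    proportional to the sum of the fourth powers of the coordinates of [u], which
    is 1 for [e_0] and 337/625 for [(3/5, 4/5, 0, ...)]. A reflection exchanges
    these two vectors, so the coefficient of the diagonal part vanishes
    identically ([diagonal_part_eq0]). This is the invariant theory of the
    orthogonal group for tensors of order at most four, with a finite average in
    place of the Haar integral.

    Since partial derivatives commute ([derive_derive_comm]), a double sum
    depends only on how many times [a] and [b] occur in each factor, up to the
    order of the factors and the exchange of [a] and [b]. Twenty such patterns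
    exist with at most three factors and total order at most four
    ([bidegrees_normal]); their double sums are, up to powers of [d], the twenty
    operators of the multigraph library. The Leibniz rules for the Laplacian
    ([lapM], [lap_sum]) give the stated identities, and these are triangular, so
    that the multigraph library lies in the span of the other one. *)

Set Implicit Arguments.
Unset Strict Implicit.
Unset Printing Implicit Defensive.

Import Order.TTheory GRing.Theory Num.Theory.
Import numFieldNormedType.Exports.

Local Open Scope ring_scope.

(** * Symmetry of second derivatives *)

Section SymmetryOfSecondDerivatives.
Variables (R : realType) (V : normedModType R).
Implicit Types (f g : V -> R) (u v x y : V).

Local Open Scope classical_set_scope.
Local Open Scope ring_scope.

Lemma subrACA (a b c d : R) : a - b - (c - d) = a - c - (b - d).
Proof. by ring. Qed.

Lemma is_derive_along_line g x v (t : R) :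
  differentiable g (t *: v + x) ->
  is_derive t 1 (fun s : R => g (s *: v + x)) ('D_v g (t *: v + x)).
Proof.
move=> dg; have dgv := diff_derivable (v := v) dg.
suff E : (fun h : R => h^-1 *: (((fun s : R => g (s *: v + x)) \o shift t) (h *: 1)
             - g (t *: v + x)))
   = (fun h => h^-1 *: ((g \o shift (t *: v + x)) (h *: v) - g (t *: v + x))).
  by split; rewrite /derivable /derive E.
apply/funext => h /=; congr (_ *: (g _ - _)).
by rewrite [h *: 1]mulr1 scalerDl addrA.
Qed.

Lemma MVT_along_line g x v (h : R) : 0 < h -> (forall y, differentiable g y) ->
  exists2 s, 0 < s < h &
    g (h *: v + x) - g x = 'D_v g (s *: v + x) * h.
Proof.
move=> h0 dg.
have d1 t := is_derive_along_line (dg (t *: v + x)).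
have [|s sh E] := @MVT R (fun s : R => g (s *: v + x)) _ 0 h h0 (fun t _ => d1 t).
  apply: continuous_subspaceT => t; apply: differentiable_continuous.
  by apply/derivable1_diffP/ex_derive; exact: d1.
exists s; first by move: sh; rewrite in_itv.
by move: E; rewrite scale0r add0r subr0.
Qed.

(** The second difference is symmetric in [u] and [v]; comparing its two
    evaluations by the mean value theorem is what makes mixed derivatives agree. *)
Lemma second_difference_sym f x u v (h : R) :
  f (h *: u + (h *: v + x)) - f (h *: v + x) - (f (h *: u + x) - f x)
  = f (h *: v + (h *: u + x)) - f (h *: u + x) - (f (h *: v + x) - f x).
Proof. by rewrite [h *: u + (_ + x)]addrCA subrACA. Qed.

(** Two mean value theorems: one in the direction [u] for
    [y |-> f (y + h v) - f y], then one in the direction [v] for its derivative. *)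
Lemma second_difference_MVT f x u v (h : R) : 0 < h ->
  (forall y, differentiable f y) -> (forall y, differentiable ('D_u f) y) ->
  exists s t, [/\ 0 < s < h, 0 < t < h &
    f (h *: u + (h *: v + x)) - f (h *: v + x) - (f (h *: u + x) - f x)
    = 'D_v ('D_u f) (t *: v + (s *: u + x)) * h * h].
Proof.
move=> h0 df ddf.
pose g y := f (y + h *: v) - f y.
have dsh y w : differentiable (fun z : V => z + w) y by exact: differentiableD.
have dfs y : differentiable (fun z => f (z + h *: v)) y.
  by apply: (@differentiable_comp _ _ _ _ (fun z => z + h *: v) f).
have dg y : differentiable g y by exact: differentiableB.
have [s sh Es] := MVT_along_line x u h0 dg.
have [t th Et] := MVT_along_line (s *: u + x) v h0 ddf.
exists s, t; split => //; rewrite -Et.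
have Dg y : 'D_u g y = 'D_u f (y + h *: v) - 'D_u f y.
  rewrite (deriveB (diff_derivable (v := u) (dfs y)) (diff_derivable (v := u) (df y))).
  suff E : (fun r : R => r^-1 *: (((fun z => f (z + h *: v)) \o shift y) (r *: u)
                                  - f (y + h *: v)))
         = (fun r => r^-1 *: ((f \o shift (y + h *: v)) (r *: u) - f (y + h *: v))).
    by rewrite /derive E.
  by apply/funext => r /=; rewrite addrA.
move: Es; rewrite Dg /g.
rewrite [s *: u + x + _]addrC -[h *: u + x + _]addrA [x + h *: v]addrC => <-.
by rewrite subrACA.
Qed.

Lemma dist_le_common (a b c e : R) : `|a - c| < e / 2 -> `|b - c| < e / 2 ->
  `|a - b| <= e.
Proof.
move=> ac bc; rewrite -(subrKA c) (le_trans (ler_normD _ _))// [e]splitr lerD// ltW//.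
by rewrite distrC.
Qed.

(** Both mixed derivatives, at points tending to [x], equal the second difference
    divided by [h ^+ 2]; continuity carries the equality to [x]. *)
Lemma derive_derive_comm f u v x :
  (forall y, differentiable f y) ->
  (forall y, differentiable ('D_u f) y) -> (forall y, differentiable ('D_v f) y) ->
  {for x, continuous ('D_v ('D_u f))} -> {for x, continuous ('D_u ('D_v f))} ->
  'D_v ('D_u f) x = 'D_u ('D_v f) x.
Proof.
move=> df du dv cvu cuv.
apply/eqP; rewrite -subr_eq0 -normr_eq0 eq_le normr_ge0 andbT.
apply/ler_addgt0Pr => e e0; rewrite add0r.
have e2 : 0 < e / 2 by rewrite divr_gt0.
have /cvgrPdist_lt/(_ _ e2) n1 := cvu.
have /cvgrPdist_lt/(_ _ e2) n2 := cuv.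
have /nbhs_ballP[r /= r0 sub] : nbhs x (fun y =>
    `|'D_v ('D_u f) x - 'D_v ('D_u f) y| < e / 2 /\
    `|'D_u ('D_v f) x - 'D_u ('D_v f) y| < e / 2) by exact: filterI n1 n2.
(* With [h = r / M] all intermediate points stay in the ball of radius [r]; the
   summand 1 keeps [M] positive when [u = v = 0]. *)
pose M := `|u| + `|v| + 1.
have M0 : 0 < M by rewrite ltr_wpDl ?addr_ge0.
have h0 : 0 < r / M by rewrite divr_gt0.
have small s t : 0 < s < r / M -> 0 < t < r / M -> ball x r (t *: v + (s *: u + x)).
  move=> /andP[s0 sh] /andP[t0 th]; rewrite -ball_normE /ball_ /=.
  rewrite addrA opprD [- _ - x]addrC addNKr normrN.
  rewrite (le_lt_trans (ler_normD _ _))// !normrZ !gtr0_norm//.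
  have -> : r = r / M * `|v| + r / M * `|u| + r / M.
    by rewrite -[X in _ + X]mulr1 -!mulrDr [`|v| + _]addrC -/M divfK // gt_eqF.
  rewrite ltr_pwDr// lerD// ler_wpM2r// ltW//.
have [s [t [sh th E1]]] := second_difference_MVT x v h0 df du.
have [t' [s' [th' sh' E2]]] := second_difference_MVT x u h0 df dv.
have small' : ball x r (s' *: u + (t' *: v + x)).
  by rewrite addrCA; exact: small.
have [b1 _] := sub _ (small _ _ sh th).
have [_ b2] := sub _ small'.
have E12 := etrans (esym E1) (etrans (second_difference_sym f x u v _) E2).
have hn0 : r / M != 0 by rewrite gt_eqF.
move: E12 => /(mulIf hn0) /(mulIf hn0) EE.
by rewrite EE in b1; exact: dist_le_common b1 b2.
Qed.
End SymmetryOfSecondDerivatives.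

(** * Calculus of smooth functions *)

Section SmoothCalculus.
Variables (R : realType) (d : nat).
Implicit Types (f g : scalar_fun R d) (x : 'cV[R]_d) (i j a : 'I_d) (s : seq 'I_d).

Lemma smooth_differentiable f x : smooth f -> differentiable f x.
Proof. by move=> /(_ [::]). Qed.

Lemma iter_partial_rcons s i f :
  iter_partial (rcons s i) f = iter_partial s (partial i f).
Proof. by rewrite /iter_partial foldr_rcons. Qed.

Lemma smooth_partial i f : smooth f -> smooth (partial i f).
Proof. by move=> sf s x; rewrite -iter_partial_rcons; exact: sf. Qed.

Lemma smooth_iter_partial s f : smooth f -> smooth (iter_partial s f).
Proof. by move=> sf; elim: s => //= i s; exact: smooth_partial. Qed.

Lemma partialC i j f : smooth f ->
  partial i (partial j f) = partial j (partial i f).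
Proof.
move=> sf; apply/funext => x; apply: derive_derive_comm.
- by move=> y; exact: smooth_differentiable.
- by move=> y; apply: smooth_differentiable; exact: (smooth_partial j).
- by move=> y; apply: smooth_differentiable; exact: (smooth_partial i).
- apply: differentiable_continuous; apply: (@smooth_differentiable (partial i (partial j f))).
  by do 2![apply: smooth_partial].
- apply: differentiable_continuous; apply: (@smooth_differentiable (partial j (partial i f))).
  by do 2![apply: smooth_partial].
Qed.

Lemma partial_cst i (k : R) : partial i (fun=> k) = (fun=> 0).
Proof. by apply/funext => x; exact: derive_cst. Qed.

Lemma partialD i f g : smooth f -> smooth g ->
  partial i (fun y => f y + g y) = (fun y => partial i f y + partial i g y).
Proof.
move=> sf sg; apply/funext => x.
by apply: deriveD; apply: diff_derivable; exact: smooth_differentiable.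
Qed.

Lemma partialM i f g : smooth f -> smooth g ->
  partial i (fun y => f y * g y)
  = (fun y => partial i f y * g y + f y * partial i g y).
Proof.
move=> sf sg; apply/funext => x; rewrite addrC [_ * g x]mulrC.
by apply: deriveM; apply: diff_derivable; exact: smooth_differentiable.
Qed.

(** The closure of the smooth functions under sums and products consists of
    differentiable functions and is stable under partial derivatives, hence all
    its members are smooth: iterated derivatives of products are never
    expanded. *)
Inductive smooth_alg : scalar_fun R d -> Prop :=
| SmoothBase f of smooth f : smooth_alg f
| SmoothCst k : smooth_alg (fun=> k)
| SmoothAdd f g of smooth_alg f & smooth_alg g : smooth_alg (fun y => f y + g y)
| SmoothMul f g of smooth_alg f & smooth_alg g : smooth_alg (fun y => f y * g y).

Lemma smooth_alg_differentiable f x : smooth_alg f -> differentiable f x.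
Proof.
elim=> {}f; first exact: smooth_differentiable.
- exact: differentiable_cst.
- by move=> g _ df _ dg; exact: differentiableD.
- by move=> g _ df _ dg; exact: differentiableM.
Qed.

Lemma smooth_alg_partial i f : smooth_alg f -> smooth_alg (partial i f).
Proof.
elim=> {}f; first by move=> sf; exact/SmoothBase/smooth_partial.
- by rewrite partial_cst; exact: SmoothCst.
- move=> g af df ag dg.
  suff -> : partial i (fun y => f y + g y) = (fun y => partial i f y + partial i g y).
    exact: SmoothAdd.
  apply/funext => x.
  by apply: deriveD; apply: diff_derivable; exact: smooth_alg_differentiable.
- move=> g af df ag dg.
  suff -> : partial i (fun y => f y * g y)
            = (fun y => f y * partial i g y + g y * partial i f y).
    by apply: SmoothAdd; exact: SmoothMul.
  apply/funext => x.
  by apply: deriveM; apply: diff_derivable; exact: smooth_alg_differentiable.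
Qed.

Lemma smooth_alg_smooth f : smooth_alg f -> smooth f.
Proof.
move=> af s x; apply: smooth_alg_differentiable.
by elim: s => //= i s; exact: smooth_alg_partial.
Qed.

Lemma smooth_cst (k : R) : smooth ((fun=> k) : scalar_fun R d).
Proof. exact/smooth_alg_smooth/SmoothCst. Qed.

Lemma smoothD f g : smooth f -> smooth g -> smooth (fun y => f y + g y).
Proof.
by move=> sf sg; apply/smooth_alg_smooth/SmoothAdd; exact: SmoothBase.
Qed.

Lemma smoothM f g : smooth f -> smooth g -> smooth (fun y => f y * g y).
Proof.
by move=> sf sg; apply/smooth_alg_smooth/SmoothMul; exact: SmoothBase.
Qed.

Lemma smooth_sum (I : Type) (r : seq I) (F : I -> scalar_fun R d) :
  (forall k, smooth (F k)) -> smooth (fun y => \sum_(k <- r) F k y).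
Proof.
move=> sF; elim: r => [|k r IH].
  by under eq_fun do rewrite big_nil; exact: smooth_cst.
by under eq_fun do rewrite big_cons; exact: smoothD.
Qed.

Lemma partial_sum (I : Type) (r : seq I) (F : I -> scalar_fun R d) i :
  (forall k, smooth (F k)) ->
  partial i (fun y => \sum_(k <- r) F k y) = (fun y => \sum_(k <- r) partial i (F k) y).
Proof.
move=> sF; elim: r => [|k r IH].
  under eq_fun do rewrite big_nil.
  by rewrite partial_cst; under [RHS]eq_fun do rewrite big_nil.
under eq_fun do rewrite big_cons.
rewrite partialD ?IH //; last exact: smooth_sum.
by under [RHS]eq_fun do rewrite big_cons.
Qed.

End SmoothCalculus.

(** * Precomposition with monomial affine maps *)

Section Precomposition.
Variables (R : realType) (d : nat).
Implicit Types (f g : scalar_fun R d) (x b : 'cV[R]_d) (i j a : 'I_d) (s : seq 'I_d).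

Lemma mulmx_differentiable (A : 'M[R]_d) b x :
  differentiable (fun x => A *m x + b) x.
Proof.
suff -> : (fun x => A *m x + b) = (\sum_(i < d) (fun x => x i 0 *: col i A)) + cst b.
  apply: differentiableD => //; apply: differentiable_sum => i.
  exact/differentiableZl/differentiable_coord.
apply/funext => y; rewrite fctE; congr (_ + _).
rewrite fct_sumE; apply/colP => k; rewrite mxE summxE.
by apply: eq_bigr => i _; rewrite !mxE mulrC.
Qed.

Lemma partial_precomp (A : 'M[R]_d) b (w : 'I_d -> R) (tau : 'I_d -> 'I_d) a f :
  A *m delta_mx a 0 = w a *: (delta_mx (tau a) 0 : 'cV_d) -> smooth f ->
  partial a (fun x => f (A *m x + b))
  = (fun x => w a * partial (tau a) f (A *m x + b)).
Proof.
move=> Aw sf; apply/funext => x.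
have df y : differentiable f y by exact: smooth_differentiable.
transitivity ('D_(A *m delta_mx a 0) f (A *m x + b)).
  suff E : (fun h : R => h^-1 *: (((fun x => f (A *m x + b)) \o shift x)
                                   (h *: (delta_mx a 0 : 'cV_d)) - f (A *m x + b)))
        = (fun h : R => h^-1 *: ((f \o shift (A *m x + b)) (h *: (A *m delta_mx a 0))
                                  - f (A *m x + b))).
    by rewrite /partial /derive E.
  by apply/funext => h /=; rewrite mulmxDr -scalemxAr addrA.
by rewrite Aw /partial deriveE // linearZ /= -deriveE.
Qed.

(** Matrices whose columns are multiples [w a] of basis vectors [tau a]: they
    cover translations ([tau] the identity), signed permutations ([tau] a
    permutation) and the rank one matrices behind ridge functions ([tau]
    constant), and for them a partial derivative of [f (A x + b)] is a single
    partial derivative of [f]. *)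
Section Iterated.
Variables (A : 'M[R]_d) (b : 'cV[R]_d) (w : 'I_d -> R) (tau : 'I_d -> 'I_d).
Hypothesis Aw : forall a, A *m delta_mx a 0 = w a *: (delta_mx (tau a) 0 : 'cV_d).

Lemma iter_partial_precomp s f : smooth f ->
  iter_partial s (fun x => f (A *m x + b))
  = (fun x => (\prod_(a <- s) w a) * iter_partial (map tau s) f (A *m x + b)).
Proof.
move=> sf; elim: s => [|a s IH] /=.
  by apply/funext => x; rewrite big_nil mul1r.
rewrite IH; have sg := smooth_iter_partial (map tau s) sf.
have dT x : differentiable (fun x => iter_partial (map tau s) f (A *m x + b)) x.
  apply: (@differentiable_comp _ _ _ _ (fun x => A *m x + b)).
    exact: mulmx_differentiable.
  exact: smooth_differentiable.
apply/funext => x; rewrite big_cons [w a * _]mulrC -mulrA.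
have := congr1 (fun h => h x) (partial_precomp b (Aw a) sg) => /= <-.
by apply: deriveZ; exact: diff_derivable.
Qed.

Lemma smooth_precomp f : smooth f -> smooth (fun x => f (A *m x + b)).
Proof.
move=> sf s x; rewrite iter_partial_precomp //.
apply: (@differentiableM _ _ (cst _)) => //.
apply: (@differentiable_comp _ _ _ _ (fun x => A *m x + b)).
  exact: mulmx_differentiable.
exact/smooth_differentiable/smooth_iter_partial.
Qed.

End Iterated.
End Precomposition.

(** * Leibniz identities for the Laplacian *)

Section Identities.
Variables (R : realType) (d : nat).
Implicit Types (f g : scalar_fun R d) (x : 'cV[R]_d) (i j : 'I_d).

Definition grad_dot f g : scalar_fun R d :=
  fun x => \sum_i partial i f x * partial i g x.

Lemma grad_dotE f g x : inner (grad f x) (grad g x) = grad_dot f g x.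
Proof. by apply: eq_bigr => i _; rewrite !mxE. Qed.

Lemma normsq_gradE f : normsq_grad f = grad_dot f f.
Proof. by apply/funext => x; rewrite -grad_dotE. Qed.

Lemma grad_lap_gradE f : grad_lap_grad f = grad_dot (lap f) f.
Proof. by apply/funext => x; rewrite -grad_dotE. Qed.

Lemma normsq_hessE f :
  normsq_hess f = fun x => \sum_i \sum_j partial i (partial j f) x ^+ 2.
Proof.
by apply/funext => x; do 2![apply: eq_bigr => ? _]; rewrite !mxE.
Qed.

Lemma hess_grad_gradE f : hess_grad_grad f =
  fun x => \sum_i \sum_j partial i (partial j f) x * partial i f x * partial j f x.
Proof.
by apply/funext => x; do 2![apply: eq_bigr => ? _]; rewrite !mxE.
Qed.

Lemma grad_dotC f g x : grad_dot f g x = grad_dot g f x.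
Proof. by apply: eq_bigr => i _; rewrite mulrC. Qed.

Lemma smooth_lap f : smooth f -> smooth (lap f).
Proof. by move=> sf; apply: smooth_sum => i; do 2!apply: smooth_partial. Qed.

Lemma smooth_grad_dot f g : smooth f -> smooth g -> smooth (grad_dot f g).
Proof.
by move=> sf sg; apply: smooth_sum => i; apply: smoothM; exact: smooth_partial.
Qed.

Lemma smoothZ k f : smooth f -> smooth (fun y => k * f y).
Proof. by move=> sf; exact: (smoothM (smooth_cst k) sf). Qed.

Lemma grad_dotM f g h : smooth f -> smooth g -> smooth h ->
  grad_dot (fun y => f y * g y) h
  = fun x => g x * grad_dot f h x + f x * grad_dot g h x.
Proof.
move=> sf sg sh; apply/funext => x; rewrite !mulr_sumr -big_split.
by apply: eq_bigr => i _; rewrite partialM //=; ring.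
Qed.

Lemma lap_sum (I : Type) (r : seq I) (F : I -> scalar_fun R d) :
  (forall k, smooth (F k)) ->
  lap (fun y => \sum_(k <- r) F k y) = (fun x => \sum_(k <- r) lap (F k) x).
Proof.
move=> sF; apply/funext => x; rewrite exchange_big; apply: eq_bigr => i _ /=.
by rewrite !partial_sum // => k; exact: smooth_partial.
Qed.

Lemma lapD f g : smooth f -> smooth g ->
  lap (fun y => f y + g y) = fun x => lap f x + lap g x.
Proof.
move=> sf sg; apply/funext => x; rewrite -big_split; apply: eq_bigr => i _ /=.
by rewrite !partialD //; exact: smooth_partial.
Qed.

Lemma lapM f g : smooth f -> smooth g ->
  lap (fun y => f y * g y)
  = fun x => f x * lap g x + g x * lap f x + 2 * grad_dot f g x.
Proof.
move=> sf sg; apply/funext => x; rewrite !mulr_sumr -!big_split.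
apply: eq_bigr => i _ /=.
have [sfi sgi] := (smooth_partial i sf, smooth_partial i sg).
rewrite partialM // partialD; [|exact: smoothM|exact: smoothM].
rewrite !partialM //.
generalize (partial i (partial i f) x) (partial i (partial i g) x) (partial i f x)
  (partial i g x) (f x) (g x) => f2 g2 f1 g1 f0 g0.
by ring.
Qed.

Lemma partialZ k i f : smooth f ->
  partial i (fun y => k * f y) = fun x => k * partial i f x.
Proof.
move=> sf; rewrite (partialM i (smooth_cst k) sf) partial_cst.
by apply/funext => x; rewrite mul0r add0r.
Qed.

Lemma lapZ k f : smooth f -> lap (fun y => k * f y) = fun x => k * lap f x.
Proof.
move=> sf; apply/funext => x; rewrite mulr_sumr; apply: eq_bigr => i _.
by rewrite !partialZ //; exact: smooth_partial.
Qed.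

Lemma partial_lap i f : smooth f -> partial i (lap f) = lap (partial i f).
Proof.
move=> sf; rewrite /lap partial_sum; last first.
  by move=> j; do 2!apply: smooth_partial.
apply/funext => x; apply: eq_bigr => j _.
by rewrite (partialC i j) ?(partialC i j) //; exact: smooth_partial.
Qed.

Lemma grad_dot_normsq_grad f : smooth f ->
  grad_dot f (normsq_grad f) = fun x => 2 * hess_grad_grad f x.
Proof.
move=> sf; apply/funext => x; rewrite normsq_gradE hess_grad_gradE mulr_sumr.
apply: eq_bigr => i _; rewrite partial_sum; last first.
  by move=> j; apply: smoothM; exact: smooth_partial.
rewrite !mulr_sumr; apply: eq_bigr => j _.
rewrite partialM; [|exact: smooth_partial|exact: smooth_partial].
generalize (partial i (partial j f) x) (partial i f x) (partial j f x) => fij fi fj.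
by ring.
Qed.

Lemma lap_square f : smooth f ->
  lap (fun y => f y ^+ 2) = fun x => 2 * (f x * lap f x) + 2 * normsq_grad f x.
Proof.
move=> sf; under eq_fun do rewrite expr2.
by rewrite lapM // normsq_gradE; apply/funext => x; ring.
Qed.

Lemma lap_normsq_grad f : smooth f ->
  lap (normsq_grad f) = fun x => 2 * grad_lap_grad f x + 2 * normsq_hess f x.
Proof.
move=> sf; rewrite normsq_gradE grad_lap_gradE normsq_hessE lap_sum; last first.
  by move=> i; apply: smoothM; exact: smooth_partial.
apply/funext => x; rewrite [in RHS]exchange_big !mulr_sumr -big_split.
apply: eq_bigr => i _ /=; have sfi := smooth_partial i sf.
rewrite lapM // -partial_lap //.
have -> : \sum_j partial j (partial i f) x ^+ 2
          = grad_dot (partial i f) (partial i f) x by [].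
by ring.
Qed.

Lemma lap_cube f : smooth f -> lap (fun y => f y ^+ 3)
  = fun x => 3 * (f x ^+ 2 * lap f x) + 6 * (f x * normsq_grad f x).
Proof.
move=> sf; have sf2 := smoothM sf sf.
have -> : (fun y => f y ^+ 3) = (fun y => f y * (f y * f y)).
  by apply/funext => y; ring.
rewrite lapM //; apply/funext => x; rewrite grad_dotC grad_dotM // lapM //.
by rewrite normsq_gradE; ring.
Qed.

Lemma smooth_normsq_grad f : smooth f -> smooth (normsq_grad f).
Proof. by move=> sf; rewrite normsq_gradE; exact: smooth_grad_dot. Qed.

Lemma lap_mul_normsq_grad f : smooth f ->
  lap (fun y => f y * normsq_grad f y) = fun x =>
    2 * (f x * grad_lap_grad f x) + 2 * (f x * normsq_hess f x)
    + 4 * hess_grad_grad f x + normsq_grad f x * lap f x.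
Proof.
move=> sf; have sn := smooth_normsq_grad sf.
rewrite lapM // grad_dot_normsq_grad // lap_normsq_grad //.
by apply/funext => x; ring.
Qed.

Lemma bilap_square f : smooth f -> bilap (fun y => f y ^+ 2) = fun x =>
  2 * (f x * bilap f x) + 8 * grad_lap_grad f x + 4 * normsq_hess f x
  + 2 * lap f x ^+ 2.
Proof.
move=> sf; have sn := smooth_normsq_grad sf; have sl := smooth_lap sf.
have sfl := smoothM sf sl.
rewrite /bilap lap_square // lapD; [|exact: smoothZ|exact: smoothZ].
rewrite !lapZ // lapM // lap_normsq_grad //; apply/funext => x.
rewrite grad_dotC -grad_lap_gradE.
generalize (f x) (lap f x) (lap (lap f) x) (grad_lap_grad f x) (normsq_hess f x)
  (normsq_grad f x) => f0 l b c h n.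
by ring.
Qed.

Lemma bilap_cube f : smooth f -> bilap (fun y => f y ^+ 3) = fun x =>
  3 * (f x ^+ 2 * bilap f x) + 24 * (f x * grad_lap_grad f x)
  + 12 * (f x * normsq_hess f x) + 6 * (f x * lap f x ^+ 2)
  + 24 * hess_grad_grad f x + 12 * (normsq_grad f x * lap f x).
Proof.
move=> sf; have sn := smooth_normsq_grad sf; have sl := smooth_lap sf.
have sf2 : smooth (fun y => f y ^+ 2) by exact: smoothM.
have sfl := smoothM sf2 sl; have sfn := smoothM sf sn.
rewrite /bilap lap_cube // lapD; [|exact: smoothZ|exact: smoothZ].
rewrite !lapZ // lapM // lap_square // lap_mul_normsq_grad //.
apply/funext => x; rewrite (grad_dotM sf sf) // (grad_dotC f) -grad_lap_gradE.
generalize (f x) (lap f x) (lap (lap f) x) (grad_lap_grad f x) (normsq_hess f x)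
  (normsq_grad f x) (hess_grad_grad f x) => f0 l b c h n q.
by ring.
Qed.

End Identities.

(** * Averaging words over signed permutations *)

Section SignedPermutationAverage.
Variables (R : realType) (d : nat).
Hypothesis d2 : (2 <= d)%N.
Implicit Types (F : seq 'I_d -> R) (w : seq 'I_d) (q : seq bool) (a b i j : 'I_d).

Definition signs := {ffun 'I_d -> bool}.

Definition sign_word (e : signs) w : R := \prod_(a <- w) (-1) ^+ e a.

Definition signed_perm_sum w F : R :=
  \sum_(e : signs) \sum_(s : {perm 'I_d}) sign_word e w * F (map s w).

Definition subst_letters q a b : seq 'I_d := [seq if c then a else b | c <- q].

Definition pairing_sum q F : R := \sum_a \sum_b F (subst_letters q a b).

(** The degenerate double sum [a = b]; it is invariant under signed permutations
    but not under the orthogonal group, so it has to be tracked separately. *)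
Definition diagonal_sum F : R := \sum_a F (nseq 4 a).

(** One representative for each pairing of at most four positions: two positions
    are paired when they carry the same letter. *)
Definition pairings : seq (seq bool) :=
  [:: [::]; [:: true; true]; [:: true; true; false; false];
      [:: true; false; true; false]; [:: true; false; false; true]].

(** Flipping the sign of the letter [a] is an involution of the sign patterns
    that negates the sign of the word. *)
Lemma signed_perm_sum_odd w F a : odd (count_mem a w) -> signed_perm_sum w F = 0.
Proof.
move=> odda; rewrite /signed_perm_sum; under eq_bigr do rewrite -mulr_sumr.
rewrite -mulr_suml; suff -> : \sum_(e : signs) sign_word e w = 0 by rewrite mul0r.
pose flip (e : signs) : signs := [ffun b => e b (+) (b == a)].
have flipK : involutive flip.
  by move=> e; apply/ffunP => b; rewrite !ffunE -addbA addbb addbF.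
have sign_flip e : sign_word (flip e) w = - sign_word e w.
  rewrite -mulN1r -[-1](_ : (-1) ^+ count_mem a w = _); last first.
    by rewrite -signr_odd odda.
  rewrite /sign_word; elim: w {odda} => [|b w IH]; first by rewrite !big_nil mulr1.
  by rewrite !big_cons IH ffunE signr_addb /= exprD; ring.
set S := \sum_e _; have SN : S = - S.
  rewrite -[RHS]sumrN /S (reindex_inj (inv_inj flipK)) /=.
  by apply: eq_bigr => e _; rewrite sign_flip.
by lra.
Qed.

Lemma perm_sum_const (c : R) : \sum_(s : {perm 'I_d}) c = d`!%:R * c.
Proof. by rewrite sumr_const card_Sn mulr_natl. Qed.

Lemma ord_sum_const (c : R) : \sum_(i < d) c = d%:R * c.
Proof. by rewrite sumr_const card_ord mulr_natl. Qed.

Lemma ord_sum_const_neq i (c : R) : \sum_(j | j != i) c = d.-1%:R * c.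
Proof.
rewrite mulr_natl -[in RHS](card_ord d) -(cardC1 i) -sumr_const.
by apply: eq_bigl => j; rewrite !inE.
Qed.

(** The left-hand sum does not depend on [a], by transitivity; summing it over
    all [a] reaches every index once for each permutation. *)
Lemma perm_sum1 (G : 'I_d -> R) a :
  d%:R * \sum_(s : {perm 'I_d}) G (s a) = d`!%:R * \sum_i G i.
Proof.
rewrite -perm_sum_const.
transitivity (\sum_(i < d) \sum_(s : {perm 'I_d}) G (s i)).
  rewrite -ord_sum_const; apply: eq_bigr => i _.
  rewrite (reindex_inj (mulgI (tperm i a))) /=.
  by apply: eq_bigr => s _; rewrite permM tpermR.
rewrite exchange_big; apply: eq_bigr => s _.
by rewrite [RHS](reindex_inj (@perm_inj _ s)).
Qed.

Lemma perm_2transitive a b i j : a != b -> i != j ->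
  exists s : {perm 'I_d}, s a = i /\ s b = j.
Proof.
move=> ab ij; exists (tperm a i * tperm (tperm a i b) j)%g.
split; rewrite permM tpermL //; apply: tpermD; last by rewrite eq_sym.
by rewrite -[X in _ != X](tpermL a i) (inj_eq perm_inj) eq_sym.
Qed.

(** The argument of [perm_sum1] with pairs of distinct indices, by
    2-transitivity. *)
Lemma perm_sum2 (G : 'I_d -> 'I_d -> R) a b : a != b ->
  (d * d.-1)%:R * \sum_(s : {perm 'I_d}) G (s a) (s b)
  = d`!%:R * (\sum_i \sum_j G i j - \sum_i G i i).
Proof.
move=> ab; rewrite -perm_sum_const.
have offdiag (H : 'I_d -> 'I_d -> R) :
    \sum_i \sum_j H i j - \sum_i H i i = \sum_i \sum_(j | j != i) H i j.
  rewrite -sumrB; apply: eq_bigr => i _.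
  by rewrite (bigD1 i) //= addrAC subrr add0r.
rewrite offdiag.
transitivity (\sum_(i < d) \sum_(j | j != i) \sum_(s : {perm 'I_d}) G (s i) (s j)).
  rewrite natrM -mulrA -ord_sum_const; apply: eq_bigr => i _.
  rewrite -(ord_sum_const_neq i); apply: eq_bigr => j.
  rewrite eq_sym => ij; have [t [ta tb]] := perm_2transitive ab ij.
  rewrite [RHS](reindex_inj (mulgI t^-1%g)) /=.
  by apply: eq_bigr => s _; rewrite !permM -ta -tb !permK.
under eq_bigr do rewrite exchange_big /=.
rewrite exchange_big; apply: eq_bigr => s _.
rewrite [RHS](reindex_inj (@perm_inj _ s)); apply: eq_bigr => i _.
rewrite [RHS](reindex_inj (@perm_inj _ s)); apply: eq_bigl => j.
by rewrite (inj_eq perm_inj).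
Qed.

Lemma natd_neq0 : (d%:R != 0 :> R) /\ ((d * d.-1)%:R != 0 :> R).
Proof. by case: d d2 => [|[|n]] //; rewrite !pnatr_eq0. Qed.

Lemma map_subst_letters q a b (s : 'I_d -> 'I_d) :
  map s (subst_letters q a b) = subst_letters q (s a) (s b).
Proof. by rewrite -map_comp; apply: eq_map => -[]. Qed.

Lemma sign_word_pairing (e : signs) q a b : q \in pairings ->
  sign_word e (subst_letters q a b) = 1.
Proof.
rewrite !inE /sign_word => /or4P[||| /orP[]] /eqP -> /=;
  by rewrite ?big_cons big_nil; case: (e a); case: (e b); rewrite /=; lra.
Qed.

Lemma signed_perm_sum_pairing q a b F : q \in pairings ->
  signed_perm_sum (subst_letters q a b) F
  = #|{: signs}|%:R * \sum_(s : {perm 'I_d}) F (subst_letters q (s a) (s b)).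
Proof.
move=> qP; rewrite mulr_natl -sumr_const; apply: eq_bigr => e _.
by apply: eq_bigr => s _; rewrite sign_word_pairing // mul1r map_subst_letters.
Qed.

Lemma subst_letters_diag q a : subst_letters q a a = nseq (size q) a.
Proof. by elim: q => //= c q ->; rewrite if_same. Qed.

(** For four positions and [a != b] the average only runs over distinct indices;
    completing it to a full double sum costs a diagonal sum. For [a = b] only the
    diagonal sum is left. Pairings of fewer than four positions involve at most one
    index. *)
Lemma pairing_average q a b : q \in pairings ->
  exists c e : R, (size q = 4 \/ e = 0) /\
    forall F, signed_perm_sum (subst_letters q a b) F
              = c * pairing_sum q F + e * diagonal_sum F.
Proof.
move=> qP; have [d0 dd0] := natd_neq0.
have [q4|] := boolP (size q == 4); last first.
  move=> qn4.
  have Hq i j : subst_letters q i j = subst_letters q i i.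
    by move: qP qn4; rewrite !inE => /or4P[||| /orP[]] /eqP ->.
  exists (#|{: signs}|%:R * (d`!%:R / d%:R) / d%:R), 0; split; first by right.
  move=> F; rewrite signed_perm_sum_pairing // mul0r addr0.
  have -> : pairing_sum q F = d%:R * \sum_i F (subst_letters q i i).
    rewrite mulr_sumr; apply: eq_bigr => i _; rewrite -ord_sum_const.
    by apply: eq_bigr => j _; rewrite Hq.
  rewrite -!mulrA; congr (_ * _); rewrite mulKf //.
  apply: (mulfI d0); rewrite mulrCA mulVKf //.
  rewrite -(perm_sum1 (fun i => F (subst_letters q i i)) a); congr (_ * _).
  by apply: eq_bigr => s _; rewrite Hq.
have [<-|ab] := eqVneq a b.
  exists 0, (#|{: signs}|%:R * (d`!%:R / d%:R)); split; first by left; apply/eqP.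
  move=> F; rewrite signed_perm_sum_pairing // mul0r add0r -mulrA; congr (_ * _).
  under eq_bigr do rewrite subst_letters_diag (eqP q4).
  apply: (mulfI d0); rewrite (perm_sum1 (fun i => F (nseq 4 i))).
  by rewrite mulrA mulrCA mulfV // mulr1.
pose c : R := #|{: signs}|%:R * (d`!%:R / (d * d.-1)%:R).
exists c, (- c); split; first by left; apply/eqP.
move=> F; rewrite signed_perm_sum_pairing // mulNr -mulrBr /c -mulrA; congr (_ * _).
apply: (mulfI dd0); rewrite (perm_sum2 (fun i j => F (subst_letters q i j)) ab).
rewrite mulrA mulrCA mulfV // mulr1; congr (_ * (_ - _)).
by apply: eq_bigr => i _; rewrite subst_letters_diag (eqP q4).
Qed.

Lemma even_word_pairing w : (size w <= 4)%N ->
  (forall a, ~~ odd (count_mem a w)) ->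
  exists q a b, q \in pairings /\ w = subst_letters q a b.
Proof.
have i0 : 'I_d by exists 0%N; exact: leq_trans d2.
case: w => [|a [|b [|c [|e [|]]]]] // _ ev.
- by exists [::], i0, i0; rewrite inE.
- by move: (ev a); rewrite /= eqxx.
- move: (ev a); rewrite /= eqxx; case: eqP => // -> _.
  by exists [:: true; true], a, a.
- exfalso; move: (ev a) (ev b) (ev c); rewrite /= !eqxx (eq_sym b a) (eq_sym c a) (eq_sym c b).
  by do 3!case: (_ == _).
- have [ab|nab] := eqVneq a b.
    subst b; have [ce|nce] := eqVneq c e.
      by subst e; exists [:: true; true; false; false], a, c.
    move: (ev c); rewrite /= eqxx (eq_sym e c) (negbTE nce).
    by case: (a == c).
  have [ac|nac] := eqVneq a c.
    subst c; have [be|nbe] := eqVneq b e.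
      by subst e; exists [:: true; false; true; false], a, b.
    by move: (ev b); rewrite /= eqxx (negbTE nab) (eq_sym e b) (negbTE nbe).
  have [ae|nae] := eqVneq a e.
    subst e; have [bc|nbc] := eqVneq b c.
      by subst c; exists [:: true; false; false; true], a, b.
    by move: (ev b); rewrite /= eqxx (negbTE nab) (eq_sym c b) (negbTE nbc).
  move: (ev a); rewrite /= eqxx (eq_sym b a) (eq_sym c a) (eq_sym e a).
  by rewrite (negbTE nab) (negbTE nac) (negbTE nae).
Qed.

(** The list [Q] is empty when some letter of [w] occurs an odd number of times,
    and a singleton otherwise. *)
Lemma word_average w : (size w <= 4)%N ->
  exists (Q : seq (R * seq bool)) (e : R),
    [/\ forall t, t \in Q -> t.2 \in pairings /\ size t.2 = size w,
        size w = 4 \/ e = 0 &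
        forall F, signed_perm_sum w F
                  = \sum_(t <- Q) t.1 * pairing_sum t.2 F + e * diagonal_sum F].
Proof.
move=> w4; have [/forallP ev|] := boolP [forall a, ~~ odd (count_mem a w)].
  have [q [a [b [qP ->]]]] := even_word_pairing w4 ev.
  have [c [e [e0 E]]] := pairing_average a b qP.
  exists [:: (c, q)], e; rewrite size_map; split=> // [t|F].
    by rewrite inE => /eqP ->.
  by rewrite E big_seq1.
rewrite negb_forall => /existsP[a]; rewrite negbK => odda.
exists [::], 0; split=> //; first by right.
by move=> F; rewrite (signed_perm_sum_odd _ odda) big_nil mul0r addr0.
Qed.

End SignedPermutationAverage.

(** * Polynomials in the derivatives at the origin *)

Section PolynomialInTheJet.
Variables (R : realType) (d : nat).
Implicit Types (f : scalar_fun R d) (x b : 'cV[R]_d) (s w : seq 'I_d) (ss : seq (seq 'I_d))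
  (sh : seq nat) (K L : scalar_fun R d -> R).

Definition jet_mono ss f x : R := \prod_(s <- ss) iter_partial s f x.

(** Variable coefficients enter a polynomial differential operator only through
    their values at the origin, so here the coefficients are numbers. *)
Definition jet_poly n p K : Prop :=
  exists l : seq (R * seq (seq 'I_d)),
    (forall t, t \in l -> (size t.2 <= n)%N /\ (size (flatten t.2) <= p)%N) /\
    forall f, smooth f -> K f = \sum_(t <- l) t.1 * jet_mono t.2 f 0.

Lemma jet_poly_ext n p K L : (forall f, smooth f -> K f = L f) ->
  jet_poly n p L -> jet_poly n p K.
Proof.
by move=> KL [l [hl El]]; exists l; split=> // f sf; rewrite KL // El.
Qed.

Lemma jet_poly_weaken n p n' p' K : (n <= n')%N -> (p <= p')%N ->
  jet_poly n p K -> jet_poly n' p' K.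
Proof.
move=> nn' pp' [l [hl El]]; exists l; split=> // t /hl[tn tp].
by split; [exact: leq_trans tn nn'|exact: leq_trans tp pp'].
Qed.

Lemma jet_poly_mono n p (c : R) ss : (size ss <= n)%N -> (size (flatten ss) <= p)%N ->
  jet_poly n p (fun f => c * jet_mono ss f 0).
Proof.
move=> sn sp; exists [:: (c, ss)]; split=> [t|f _]; last by rewrite big_seq1.
by rewrite inE => /eqP ->.
Qed.

Lemma jet_poly_sum (I : Type) (r : seq I) n p (K : I -> scalar_fun R d -> R) :
  (forall k, jet_poly n p (K k)) -> jet_poly n p (fun f => \sum_(k <- r) K k f).
Proof.
move=> nK; elim: r => [|k r [l [hl El]]].
  by exists [::]; split=> // f _; rewrite !big_nil.
have [l' [hl' El']] := nK k; exists (l' ++ l); split=> [t|f sf].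
  by rewrite mem_cat => /orP[/hl'|/hl].
by rewrite big_cons big_cat El' // El.
Qed.

Lemma jet_poly_mul n p n' p' K L : jet_poly n p K -> jet_poly n' p' L ->
  jet_poly (n + n') (p + p') (fun f => K f * L f).
Proof.
move=> [l [hl El]] [l' [hl' El']].
exists [seq (t.1 * t'.1, t.2 ++ t'.2) | t <- l, t' <- l']; split=> [t|f sf].
  move=> /allpairsP[[u v] /= [/hl[un up] /hl'[vn vp] ->]] /=.
  by rewrite flatten_cat !size_cat; split; exact: leq_add.
rewrite El // El' // big_allpairs_dep mulr_suml; apply: eq_bigr => t _.
rewrite mulr_sumr; apply: eq_bigr => t' _ /=.
by rewrite /jet_mono big_cat /= mulrACA.
Qed.

Lemma jet_poly_prod (I : Type) (r : seq I) (p : I -> nat) (K : I -> scalar_fun R d -> R) :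
  (forall k, jet_poly 1 (p k) (K k)) ->
  jet_poly (size r) (\sum_(k <- r) p k) (fun f => \prod_(k <- r) K k f).
Proof.
move=> nK; elim: r => [|k r IH].
  apply: jet_poly_ext (jet_poly_mono 1 (ss := [::]) _ _) => // f _.
  by rewrite /jet_mono !big_nil mulr1.
rewrite big_cons /=; apply: jet_poly_ext (jet_poly_mul (nK k) IH) => f _.
by rewrite big_cons.
Qed.

Lemma linear_pdo_jet_poly r (L : operator R d) : linear_pdo r L ->
  jet_poly 1 r (fun f => L f 0).
Proof.
move=> [m [a [s [has Lf]]]].
apply: (jet_poly_ext (L := fun f => \sum_(k < m) a k 0 * jet_mono [:: s k] f 0)).
  move=> f sf; rewrite Lf //; apply: eq_bigr => k _.
  by rewrite /jet_mono big_seq1.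
apply: jet_poly_sum => k; apply: jet_poly_mono => //=.
by rewrite cats0; case: (has k).
Qed.

Lemma polynomial_pdo_jet_poly n p (N : operator R d) : polynomial_pdo n p N ->
  jet_poly n p (fun f => N f 0).
Proof.
move=> [m [P [hP Nf]]]; apply: (jet_poly_ext (L := fun f => \sum_(k < m) P k f 0)).
  by move=> f sf; rewrite Nf.
apply: jet_poly_sum => k; have [n' [p' [n'n p'p [c [L [r [hL rp Pf]]]]]]] := hP k.
apply: jet_poly_weaken n'n p'p _.
apply: jet_poly_ext (fun f sf => Pf f sf 0) _; rewrite -rp.
have := jet_poly_mul (jet_poly_mono c (ss := [::]) (leqnn 0) (leqnn 0))
  (jet_poly_prod (index_enum 'I_n') (fun j => linear_pdo_jet_poly (hL j))).
rewrite -[index_enum _]enumT -cardE card_ord !add0n; apply: jet_poly_ext => f _.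
by rewrite /jet_mono big_nil mulr1 enumT.
Qed.

(** The monomial obtained by cutting a word into factors of prescribed orders;
    the group acts on words letter by letter, whatever the cut. *)
Definition word_mono sh f x w : R := jet_mono (reshape sh w) f x.

Lemma word_mono_precomp (A : 'M[R]_d) b (w : 'I_d -> R) (tau : 'I_d -> 'I_d) sh v f x :
  (forall a, A *m delta_mx a 0 = w a *: (delta_mx (tau a) 0 : 'cV_d)) ->
  smooth f -> size v = sumn sh ->
  word_mono sh (fun x => f (A *m x + b)) x v
  = (\prod_(a <- v) w a) * word_mono sh f (A *m x + b) (map tau v).
Proof.
move=> Aw sf vsh; rewrite /word_mono /jet_mono.
under eq_bigr do rewrite (iter_partial_precomp b Aw _ sf).
rewrite big_split /= -map_reshape big_map; congr (_ * _).
by rewrite -[in RHS](reshapeKr (eq_leq vsh)) big_flatten.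
Qed.

End PolynomialInTheJet.

(** * Equivariant operators are combinations of double sums *)

Section EquivariantOperators.
Variables (R : realType) (d : nat).
Hypothesis d2 : (2 <= d)%N.
Implicit Types (f : scalar_fun R d) (x : 'cV[R]_d) (N : operator R d) (a b i j k : 'I_d).

Lemma equivariant_affine N f (A : 'M[R]_d) x : equivariant N -> smooth f ->
  A *m A^T = 1%:M -> N (fun y => f (A *m y + x)) 0 = N f x.
Proof.
move=> eqN sf AA; have := eqN (fun y => A *m y + x) f.
have -> : f \o (fun y => A *m y + x) = fun y => f (A *m y + x) by [].
by move=> -> //; [rewrite /= mulmx0 add0r|exists A, x].
Qed.

Definition signed_perm_mx (e : signs d) (s : {perm 'I_d}) : 'M[R]_d :=
  \matrix_(i, j) ((-1) ^+ e j * (i == s j)%:R).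

Lemma signed_perm_mx_delta e s a :
  signed_perm_mx e s *m delta_mx a 0 = (-1) ^+ e a *: (delta_mx (s a) 0 : 'cV_d).
Proof. by rewrite -colE; apply/colP => i; rewrite !mxE eqxx andbT. Qed.

Lemma signed_perm_mx_orthogonal e s :
  signed_perm_mx e s *m (signed_perm_mx e s)^T = 1%:M.
Proof.
apply/matrixP => i k; rewrite !mxE (reindex_inj (@perm_inj _ s^-1%g)) /=.
rewrite (bigD1 i) //= !mxE permKV eqxx mulr1 mulrA -expr2 sqrr_sign mul1r.
rewrite big1 ?addr0 1?eq_sym // => j ji.
by rewrite !mxE permKV eq_sym (negbTE ji) mulr0 mul0r.
Qed.

(** [N f 0] is unchanged when [f] is composed with a signed permutation, so it
    equals the average over all of them. *)
Lemma jet_poly_signed_perm_sum n p N : equivariant N ->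
  jet_poly n p (fun f => N f 0) ->
  exists l : seq (R * seq (seq 'I_d)),
    (forall t, t \in l -> (size t.2 <= n)%N /\ (size (flatten t.2) <= p)%N) /\
    forall f, smooth f -> N f 0 = \sum_(t <- l)
      t.1 * signed_perm_sum (flatten t.2) (word_mono (shape t.2) f 0).
Proof.
move=> eqN [l [hl Nl]].
pose B : R := #|{: signs d}|%:R * d`!%:R.
have B0 : B != 0.
  rewrite mulf_neq0 // pnatr_eq0 -lt0n ?fact_gt0 //.
  by apply/card_gt0P; exists [ffun=> true].
exists [seq (B^-1 * t.1, t.2) | t <- l]; split=> [t /mapP[u /hl hu ->] //|f sf].
rewrite big_map; apply: (mulfI B0); rewrite mulr_sumr.
transitivity (\sum_(e : signs d) \sum_(s : {perm 'I_d}) N f 0).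
  rewrite /B -mulrA -(perm_sum_const d (N f 0)) mulr_natl -sumr_const.
  exact: eq_bigr.
have step e (s : {perm 'I_d}) : N f 0 = \sum_(t <- l)
    t.1 * (sign_word R e (flatten t.2) * word_mono (shape t.2) f 0 (map s (flatten t.2))).
  have An := signed_perm_mx_delta e s.
  rewrite -(equivariant_affine 0 eqN sf (signed_perm_mx_orthogonal e s)).
  rewrite Nl; last exact: (smooth_precomp 0 An sf).
  apply: eq_bigr => t _; congr (_ * _).
  rewrite -{1}[t.2]flattenK -/(word_mono _ _ _ _).
  by rewrite (word_mono_precomp _ _ An sf) ?size_flatten // mulmx0 addr0.
under eq_bigr => e _ do under eq_bigr => s _ do rewrite (step e s).
under eq_bigr do rewrite exchange_big.
rewrite exchange_big; apply: eq_bigr => t _ /=.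
rewrite mulrA mulVKf // /signed_perm_sum mulr_sumr.
by apply: eq_bigr => e _; rewrite mulr_sumr.
Qed.

Lemma signed_perm_sum_reduction (l : seq (R * seq (seq 'I_d))) n :
  (forall t, t \in l -> (size t.2 <= n)%N /\ (size (flatten t.2) <= 4)%N) ->
  exists (l1 : seq (R * (seq nat * seq bool))) (l2 : seq (R * seq nat)),
    [/\ forall t, t \in l1 -> [/\ t.2.2 \in pairings, size t.2.2 = sumn t.2.1
          & (size t.2.1 <= n)%N],
        forall t, t \in l2 -> sumn t.2 = 4 &
        forall f, \sum_(t <- l)
            t.1 * signed_perm_sum (flatten t.2) (word_mono (shape t.2) f 0)
          = \sum_(t <- l1) t.1 * pairing_sum t.2.2 (word_mono t.2.1 f 0)
            + \sum_(t <- l2) t.1 * diagonal_sum (word_mono t.2 f 0)].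
Proof.
elim: l => [|[c ss] l IH] hl.
  by exists [::], [::]; split=> // f; rewrite !big_nil addr0.
have [t tl|l1 [l2 [h1 h2 E]]] := IH; first by apply: hl; rewrite inE tl orbT.
have [ssn ss4] := hl _ (mem_head _ _).
have [Q [e [hQ he EQ]]] := word_average R d2 ss4.
exists ([seq (c * t.1, (shape ss, t.2)) | t <- Q] ++ l1).
exists ((if e == 0 then [::] else [:: (c * e, shape ss)]) ++ l2); split.
- move=> t; rewrite mem_cat => /orP[/mapP[u /hQ[uP us] ->] /=|/h1 //].
  by rewrite uP us size_flatten size_map.
- move=> t; rewrite mem_cat => /orP[|/h2 //]; case: eqP => // e0.
  by rewrite inE => /eqP -> /=; rewrite -size_flatten; case: he.
- move=> f; rewrite big_cons E EQ !big_cat big_map /= mulrDr mulr_sumr.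
  rewrite addrACA; congr (_ + _ + (_ + _)); first by apply: eq_bigr => t _; rewrite mulrA.
  by case: eqP => [->|_]; rewrite ?big_nil ?big_seq1 ?mul0r ?mulr0 // mulrA.
Qed.

Definition line_mx (u : 'I_d -> R) i : 'M[R]_d := \matrix_(k, a) (u a * (k == i)%:R).

Lemma line_mx_delta u i a :
  line_mx u i *m delta_mx a 0 = u a *: (delta_mx i 0 : 'cV_d).
Proof. by rewrite -colE; apply/colP => k; rewrite !mxE eqxx andbT. Qed.

(** The function [x |-> f ((u . x) e_i)]. *)
Definition ridge f u i : scalar_fun R d := fun x => f (line_mx u i *m x + 0).

Lemma smooth_ridge f u i : smooth f -> smooth (ridge f u i).
Proof. by move=> sf; exact: (smooth_precomp 0 (line_mx_delta u i) sf). Qed.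

Lemma word_mono_ridge sh f u i v : smooth f -> size v = sumn sh ->
  word_mono sh (ridge f u i) 0 v
  = (\prod_(a <- v) u a) * word_mono sh f 0 (nseq (sumn sh) i).
Proof.
move=> sf vsh; rewrite (word_mono_precomp 0 0 (line_mx_delta u i)) //.
rewrite mulmx0 addr0 -vsh; congr (_ * word_mono _ _ _ _).
by elim: v {vsh} => //= _ v ->.
Qed.

(** The double sums of products of coordinates of [u] are powers of the squared
    norm of [u], up to powers of [d]. *)
Lemma pairing_sum_ridge sh q f u v i : q \in pairings -> size q = sumn sh -> smooth f ->
  \sum_a u a ^+ 2 = 1 -> \sum_a v a ^+ 2 = 1 ->
  pairing_sum q (word_mono sh (ridge f u i) 0)
  = pairing_sum q (word_mono sh (ridge f v i) 0).
Proof.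
move=> qP qsh sf u1 v1; rewrite /pairing_sum.
have dist w : \sum_a \sum_b word_mono sh (ridge f w i) 0 (subst_letters q a b)
    = (\sum_a \sum_b \prod_(k <- subst_letters q a b) w k)
      * word_mono sh f 0 (nseq (sumn sh) i).
  rewrite mulr_suml; apply: eq_bigr => a _; rewrite mulr_suml; apply: eq_bigr => b _.
  by rewrite word_mono_ridge // size_map.
rewrite !dist; congr (_ * _).
have ev (w : 'I_d -> R) : \sum_a w a ^+ 2 = 1 ->
  (forall a b, \prod_(k <- subst_letters q a b) w k = w a ^+ 2 * w b ^+ 2) ->
  \sum_a \sum_b \prod_(k <- subst_letters q a b) w k = 1.
  move=> w1 E; rewrite -[RHS]mulr1 -[X in _ = X * _]w1 mulr_suml; apply: eq_bigr => a _.
  by rewrite -[X in _ = _ * X]w1 mulr_sumr; apply: eq_bigr => b _; rewrite E.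
move: qP ev {dist qsh}; rewrite !inE => /or4P[||| /orP[]] /eqP -> ev.
- by apply: eq_bigr => a _; apply: eq_bigr => b _; rewrite !big_nil.
- have sq (w : 'I_d -> R) : \sum_a w a ^+ 2 = 1 ->
    \sum_a \sum_(b < d) \prod_(k <- subst_letters [:: true; true] a b) w k = d%:R.
    move=> w1; rewrite -[RHS]mulr1 -[X in _ = _ * X]w1 mulr_sumr; apply: eq_bigr => a _.
    by rewrite -ord_sum_const; apply: eq_bigr => b _; rewrite !big_cons big_nil mulr1.
  by rewrite !sq.
- by rewrite !ev // => a b; rewrite !big_cons big_nil; ring.
- by rewrite !ev // => a b; rewrite !big_cons big_nil; ring.
- by rewrite !ev // => a b; rewrite !big_cons big_nil; ring.
Qed.

Lemma diagonal_sum_ridge sh f u i : sumn sh = 4 -> smooth f ->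
  diagonal_sum (word_mono sh (ridge f u i) 0)
  = (\sum_a u a ^+ 4) * word_mono sh f 0 (nseq 4 i).
Proof.
move=> sh4 sf; rewrite mulr_suml; apply: eq_bigr => a _.
rewrite word_mono_ridge ?sh4 //; congr (_ * _).
by rewrite /= !big_cons big_nil; ring.
Qed.

Let i0 : 'I_d := Ordinal (ltnW d2).
Let i1 : 'I_d := Ordinal d2.

Lemma sum_two_points (G : 'I_d -> R) :
  (forall j, j != i0 -> j != i1 -> G j = 0) -> \sum_j G j = G i0 + G i1.
Proof.
move=> G0; rewrite (bigD1 i0) //= (bigD1 i1) //=.
by rewrite big1 ?addr0 // => j /andP[]; exact: G0.
Qed.

(** The reflection along [z = e_0 - 2 e_1], whose squared norm is 5, exchanges
    [u = e_0] and [v = (3/5, 4/5, 0, ...)]. *)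
Let z (j : 'I_d) : R := (j == i0)%:R - 2 * (j == i1)%:R.
Let householder : 'M[R]_d := \matrix_(j, k) ((j == k)%:R - 2 / 5 * (z j * z k)).
Let u (j : 'I_d) : R := (j == i0)%:R.
Let v (j : 'I_d) : R := householder i0 j.

Lemma householder_orthogonal : householder *m householder^T = 1%:M.
Proof.
have zz : \sum_j z j ^+ 2 = 5.
  rewrite sum_two_points => [|j /negbTE j0 /negbTE j1].
    by rewrite /z !eqxx /=; ring.
  by rewrite /z j0 j1 /=; ring.
apply/matrixP => j k; rewrite !mxE.
under eq_bigr do rewrite !mxE.
transitivity (\sum_l ((j == l)%:R * (k == l)%:R - 2 / 5 * z k * ((j == l)%:R * z l)
   - 2 / 5 * z j * ((k == l)%:R * z l) + 4 / 25 * (z j * z k) * z l ^+ 2)).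
  by apply: eq_bigr => l _; field.
have delta (h : 'I_d -> R) (m : 'I_d) : \sum_l (m == l)%:R * h l = h m.
  rewrite (bigD1 m) //= eqxx mul1r big1 ?addr0 // => l.
  by rewrite eq_sym => /negbTE ->; rewrite mul0r.
rewrite big_split !sumrB /= -!mulr_sumr !delta zz eq_sym.
by field.
Qed.

(** The values of [N] at the ridge functions of [u] and [v] agree, and so do
    their double sums; the diagonal sums are multiples, by the factors 1 and
    337/625, of the same number, which is therefore 0. Applied to each
    direction [i], this removes the whole diagonal part at once, whatever the
    relations between its terms. *)
Lemma diagonal_part_eq0 (l2 : seq (R * seq nat)) N
  (l1 : seq (R * (seq nat * seq bool))) : equivariant N ->
  (forall t, t \in l1 -> t.2.2 \in pairings /\ size t.2.2 = sumn t.2.1) ->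
  (forall t, t \in l2 -> sumn t.2 = 4) ->
  (forall f, smooth f -> N f 0
     = \sum_(t <- l1) t.1 * pairing_sum t.2.2 (word_mono t.2.1 f 0)
       + \sum_(t <- l2) t.1 * diagonal_sum (word_mono t.2 f 0)) ->
  forall f, smooth f -> \sum_(t <- l2) t.1 * diagonal_sum (word_mono t.2 f 0) = 0.
Proof.
move=> eqN h1 h2 EN f sf.
suff Z i : \sum_(t <- l2) t.1 * word_mono t.2 f 0 (nseq 4 i) = 0.
  transitivity (\sum_i \sum_(t <- l2) t.1 * word_mono t.2 f 0 (nseq 4 i)).
    by rewrite exchange_big; apply: eq_bigr => t _; rewrite mulr_sumr.
  by rewrite big1.
have u2 : \sum_a u a ^+ 2 = 1.
  by rewrite sum_two_points /u => [|j /negbTE -> _ /=]; [rewrite eqxx /=; ring|ring].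
have [v0 v1] : v i0 = 3 / 5 /\ v i1 = 4 / 5.
  by rewrite /v /householder !mxE /z !eqxx /=; split; field.
have vj j : j != i0 -> j != i1 -> v j = 0.
  move=> j0 j1; rewrite /v mxE /z [i0 == j]eq_sym (negbTE j0) (negbTE j1) /=.
  by ring.
have v2 : \sum_a v a ^+ 2 = 1.
  rewrite sum_two_points => [|j j0 j1]; last by rewrite vj // expr0n.
  by rewrite v0 v1; field.
have u4 : \sum_a u a ^+ 4 = 1.
  by rewrite sum_two_points /u => [|j /negbTE -> _ /=]; [rewrite eqxx /=; ring|ring].
have v4 : \sum_a v a ^+ 4 = 337 / 625.
  rewrite sum_two_points => [|j j0 j1]; last by rewrite vj // expr0n.
  by rewrite v0 v1; field.
have Euv : N (ridge f u i) 0 = N (ridge f v i) 0.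
  have su := smooth_ridge u i sf.
  rewrite -(equivariant_affine 0 eqN su householder_orthogonal).
  congr (N _ 0); apply/funext => x; rewrite /ridge !addr0 mulmxA; congr (f (_ *m x)).
  apply/matrixP => k a; rewrite !mxE (bigD1 i0) //= !mxE.
  rewrite /u eqxx mul1r mulrC big1 ?addr0; first by rewrite /v mxE.
  by move=> j /negbTE j0; rewrite !mxE /u j0 !mul0r.
have dg w : \sum_(t <- l2) t.1 * diagonal_sum (word_mono t.2 (ridge f w i) 0)
  = (\sum_a w a ^+ 4) * \sum_(t <- l2) t.1 * word_mono t.2 f 0 (nseq 4 i).
  rewrite mulr_sumr [LHS]big_seq [RHS]big_seq; apply: eq_bigr => t tl2.
  by rewrite diagonal_sum_ridge ?h2 // mulrCA.
move: Euv; rewrite !EN; [|exact: smooth_ridge|exact: smooth_ridge].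
have -> : \sum_(t <- l1) t.1 * pairing_sum t.2.2 (word_mono t.2.1 (ridge f u i) 0)
  = \sum_(t <- l1) t.1 * pairing_sum t.2.2 (word_mono t.2.1 (ridge f v i) 0).
  rewrite [LHS]big_seq [RHS]big_seq; apply: eq_bigr => t /h1[tP ts].
  by rewrite (pairing_sum_ridge i tP ts sf u2 v2).
move=> /addrI; rewrite !dg u4 v4.
by lra.
Qed.

Lemma mul1mx_delta a :
  (1%:M : 'M[R]_d) *m delta_mx a 0 = 1 *: (delta_mx a 0 : 'cV_d).
Proof. by rewrite mul1mx scale1r. Qed.

Lemma word_mono_translate sh f x w : smooth f -> size w = sumn sh ->
  word_mono sh (fun y => f (1%:M *m y + x)) 0 w = word_mono sh f x w.
Proof.
move=> sf wsh; rewrite (word_mono_precomp x 0 mul1mx_delta) //.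
by rewrite mulmx0 add0r map_id big1 // mul1r.
Qed.

Lemma equivariant_pairing_sums n N : equivariant N -> polynomial_pdo n 4 N ->
  exists l : seq (R * (seq nat * seq bool)),
    (forall t, t \in l -> [/\ t.2.2 \in pairings, size t.2.2 = sumn t.2.1
       & (size t.2.1 <= n)%N]) /\
    forall f, smooth f -> forall x, N f x
      = \sum_(t <- l) t.1 * pairing_sum t.2.2 (word_mono t.2.1 f x).
Proof.
move=> eqN /polynomial_pdo_jet_poly /(jet_poly_signed_perm_sum eqN)[l [hl EN]].
have [l1 [l2 [h1 h2 E]]] := signed_perm_sum_reduction hl.
exists l1; split=> // f sf x.
have EN' g : smooth g -> N g 0
     = \sum_(t <- l1) t.1 * pairing_sum t.2.2 (word_mono t.2.1 g 0)
       + \sum_(t <- l2) t.1 * diagonal_sum (word_mono t.2 g 0).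
  by move=> sg; rewrite EN.
have h1' t : t \in l1 -> t.2.2 \in pairings /\ size t.2.2 = sumn t.2.1 by move=> /h1[].
have sg := smooth_precomp x mul1mx_delta sf.
have I1 : (1%:M : 'M[R]_d) *m 1%:M^T = 1%:M by rewrite trmx1 mulmx1.
rewrite -(equivariant_affine x eqN sf I1).
rewrite EN' // (diagonal_part_eq0 eqN h1' h2 EN' sg) addr0.
rewrite [LHS]big_seq [RHS]big_seq; apply: eq_bigr => t /h1[tP ts _].
congr (_ * _); apply: eq_bigr => a _; apply: eq_bigr => b _.
by rewrite word_mono_translate // size_map.
Qed.

End EquivariantOperators.

(** * Normal forms of double sums *)

Section TwoLetterSums.
Variables (R : realType) (d : nat).
Implicit Types (f : scalar_fun R d) (x : 'cV[R]_d) (s : seq 'I_d) (a b : 'I_d)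
  (q r : seq bool) (t : nat * nat) (T : seq (nat * nat)).

Lemma partial_iter_partial a s f : smooth f ->
  partial a (iter_partial s f) = iter_partial s (partial a f).
Proof.
move=> sf; elim: s => //= b s IH.
by rewrite partialC ?IH //; exact: smooth_iter_partial.
Qed.

Lemma iter_partialC s s' f : smooth f ->
  iter_partial s (iter_partial s' f) = iter_partial s' (iter_partial s f).
Proof.
move=> sf; elim: s => //= a s ->; rewrite partial_iter_partial //.
exact: smooth_iter_partial.
Qed.

Definition bipartial a b t f : scalar_fun R d :=
  iter_partial (nseq t.1 a) (iter_partial (nseq t.2 b) f).

Definition swap t := (t.2, t.1).

Lemma bipartial_swap a b t f : smooth f -> bipartial a b (swap t) f = bipartial b a t f.
Proof. exact: iter_partialC. Qed.

Definition bidegree r := (count id r, count negb r).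

Lemma iter_partial_bidegree r a b f : smooth f ->
  iter_partial (subst_letters r a b) f = bipartial a b (bidegree r) f.
Proof.
move=> sf; elim: r => //= -[] r ->; rewrite //= /bipartial /=.
by rewrite partial_iter_partial //; exact: smooth_iter_partial.
Qed.

Definition two_letter_sum T f x : R :=
  \sum_a \sum_b \prod_(t <- T) bipartial a b t f x.

Definition bidegrees sh q := [seq bidegree r | r <- reshape sh q].

Lemma pairing_sum_bidegrees sh q f x : smooth f ->
  pairing_sum q (word_mono sh f x) = two_letter_sum (bidegrees sh q) f x.
Proof.
move=> sf; apply: eq_bigr => a _; apply: eq_bigr => b _.
rewrite /word_mono /jet_mono /bidegrees big_map -map_reshape big_map.
by apply: eq_bigr => r _; rewrite -/(subst_letters r a b) iter_partial_bidegree.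
Qed.

Lemma two_letter_sum_perm T T' f x : perm_eq T T' ->
  two_letter_sum T f x = two_letter_sum T' f x.
Proof.
by move=> TT'; apply: eq_bigr => a _; apply: eq_bigr => b _; exact: perm_big.
Qed.

Lemma two_letter_sum_swap T f x : smooth f ->
  two_letter_sum (map swap T) f x = two_letter_sum T f x.
Proof.
move=> sf; rewrite /two_letter_sum exchange_big; apply: eq_bigr => a _.
apply: eq_bigr => b _; rewrite big_map; apply: eq_bigr => t _.
by rewrite bipartial_swap.
Qed.

(** Each entry lists, factor by factor, the orders of differentiation in the two
    summation indices; the entries are in the order of the multigraph library. *)
Definition normal_bidegrees : seq (seq (nat * nat)) := [::
  [::]; [:: (0, 0)]; [:: (2, 0)]; [:: (2, 2)];
  [:: (0, 0); (0, 0)]; [:: (0, 0); (2, 0)]; [:: (1, 0); (1, 0)];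
  [:: (0, 0); (2, 2)]; [:: (1, 2); (1, 0)]; [:: (1, 1); (1, 1)]; [:: (2, 0); (0, 2)];
  [:: (0, 0); (0, 0); (0, 0)]; [:: (0, 0); (0, 0); (2, 0)];
  [:: (0, 0); (1, 0); (1, 0)]; [:: (0, 0); (0, 0); (2, 2)];
  [:: (0, 0); (1, 2); (1, 0)]; [:: (0, 0); (1, 1); (1, 1)];
  [:: (0, 0); (2, 0); (0, 2)]; [:: (1, 1); (1, 0); (0, 1)];
  [:: (1, 0); (1, 0); (0, 2)]]%N.

(** A finite check over the ways to cut a pairing of at most four positions into
    at most three factors. *)
Lemma bidegrees_normal sh q : q \in pairings -> size q = sumn sh -> (size sh <= 3)%N ->
  has (fun T => perm_eq (bidegrees sh q) T || perm_eq (map swap (bidegrees sh q)) T)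
    normal_bidegrees.
Proof.
rewrite !inE; case: sh => [|m [|n [|p [|? ?]]]] // qP qs _; move: qs;
  rewrite [sumn _]/= ?addn0; move: qP.
- by move=> /or4P[||| /orP[]] /eqP -> <-.
- by case: m n => [|[|[|[|[|m]]]]] [|[|[|[|[|n]]]]] /or4P[||| /orP[]] /eqP ->.
- by case: m n p => [|[|[|[|[|m]]]]] [|[|[|[|[|n]]]]] [|[|[|[|[|p]]]]]
    /or4P[||| /orP[]] /eqP ->.
Qed.

End TwoLetterSums.

(** * The span of the library *)

Section LibrarySpan.
Variables (R : realType) (d : nat).
Implicit Types (f : scalar_fun R d) (x : 'cV[R]_d) (K L : operator R d) (k : R)
  (T : seq (nat * nat)).

Definition in_span K : Prop := exists c : 'I_20 -> R, forall f, smooth f ->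
  forall x, K f x = \sum_(i < 20) c i * tnth (lib_MM R d) i f x.

Lemma in_span_ext K L : in_span L ->
  (forall f, smooth f -> forall x, K f x = L f x) -> in_span K.
Proof. by move=> [c Lc] KL; exists c => f sf x; rewrite KL // Lc. Qed.

Lemma in_spanD K L : in_span K -> in_span L -> in_span (fun f x => K f x + L f x).
Proof.
move=> [c Kc] [e Le]; exists (fun i => c i + e i) => f sf x.
by rewrite Kc // Le // -big_split; apply: eq_bigr => i _; rewrite mulrDl.
Qed.

Lemma in_spanZ k K : in_span K -> in_span (fun f x => k * K f x).
Proof.
move=> [c Kc]; exists (fun i => k * c i) => f sf x.
by rewrite Kc // mulr_sumr; apply: eq_bigr => i _; rewrite mulrA.
Qed.

Lemma in_span_sum (I : eqType) (r : seq I) (K : I -> operator R d) :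
  (forall i, i \in r -> in_span (K i)) ->
  in_span (fun f x => \sum_(i <- r) K i f x).
Proof.
elim: r => [|i r IH] hK.
  by exists (fun=> 0) => f sf x; rewrite big_nil big1 // => i _; rewrite mul0r.
have hr : in_span (fun f x => \sum_(i <- r) K i f x).
  by apply: IH => j jr; apply: hK; rewrite inE jr orbT.
apply: in_span_ext (in_spanD (hK i (mem_head _ _)) hr) _ => f sf x.
by rewrite big_cons.
Qed.

Lemma in_span_lib m (hm : (m < 20)%N) : in_span (tnth (lib_MM R d) (Ordinal hm)).
Proof.
exists (fun i => (i == Ordinal hm)%:R) => f sf x.
rewrite (bigD1 (Ordinal hm)) //= eqxx mul1r big1 ?addr0 // => i /negbTE ->.
by rewrite mul0r.
Qed.

Let one : in_span (fun f x => 1) := in_span_lib (m := 0) isT.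
Let id1 : in_span (fun f x => f x) := in_span_lib (m := 1) isT.
Let lap1 : in_span (fun f x => lap f x) := in_span_lib (m := 2) isT.
Let bilap1 : in_span (fun f x => bilap f x) := in_span_lib (m := 3) isT.
Let id2 : in_span (fun f x => f x ^+ 2) := in_span_lib (m := 4) isT.
Let lapsq : in_span (fun f x => lap (fun y => f y ^+ 2) x) := in_span_lib (m := 5) isT.
Let nrm : in_span (fun f x => normsq_grad f x) := in_span_lib (m := 6) isT.
Let bilapsq : in_span (fun f x => bilap (fun y => f y ^+ 2) x) := in_span_lib (m := 7) isT.
Let lapnrm : in_span (fun f x => lap (normsq_grad f) x) := in_span_lib (m := 8) isT.
Let nh : in_span (fun f x => normsq_hess f x) := in_span_lib (m := 9) isT.
Let lap2 : in_span (fun f x => lap f x ^+ 2) := in_span_lib (m := 10) isT.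
Let id3 : in_span (fun f x => f x ^+ 3) := in_span_lib (m := 11) isT.
Let lapcube : in_span (fun f x => lap (fun y => f y ^+ 3) x) := in_span_lib (m := 12) isT.
Let fnrm : in_span (fun f x => f x * normsq_grad f x) := in_span_lib (m := 13) isT.
Let bilapcube : in_span (fun f x => bilap (fun y => f y ^+ 3) x) := in_span_lib (m := 14) isT.
Let lapfnrm : in_span (fun f x => lap (fun y => f y * normsq_grad f y) x) :=
  in_span_lib (m := 15) isT.
Let fnh : in_span (fun f x => f x * normsq_hess f x) := in_span_lib (m := 16) isT.
Let flap2 : in_span (fun f x => f x * lap f x ^+ 2) := in_span_lib (m := 17) isT.
Let hgg : in_span (fun f x => hess_grad_grad f x) := in_span_lib (m := 18) isT.
Let nlap : in_span (fun f x => normsq_grad f x * lap f x) := in_span_lib (m := 19) isT.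

Lemma in_span_mul_lap : in_span (fun f x => f x * lap f x).
Proof.
apply: in_span_ext (in_spanD (in_spanZ (1 / 2) lapsq) (in_spanZ (- 1) nrm)) _.
by move=> f sf x; rewrite lap_square //; field.
Qed.

Lemma in_span_grad_lap_grad : in_span (fun f x => grad_lap_grad f x).
Proof.
apply: in_span_ext (in_spanD (in_spanZ (1 / 2) lapnrm) (in_spanZ (- 1) nh)) _.
by move=> f sf x; rewrite lap_normsq_grad //; field.
Qed.

Lemma in_span_mul_bilap : in_span (fun f x => f x * bilap f x).
Proof.
apply: in_span_ext (in_spanD (in_spanZ (1 / 2) bilapsq)
  (in_spanD (in_spanZ (- 4) in_span_grad_lap_grad)
     (in_spanD (in_spanZ (- 2) nh) (in_spanZ (- 1) lap2)))) _.
move=> f sf x; rewrite bilap_square //.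
generalize (f x) (lap f x) (bilap f x) (grad_lap_grad f x) (normsq_hess f x) => f0 l b c h.
by field.
Qed.

Lemma in_span_sqr_lap : in_span (fun f x => f x ^+ 2 * lap f x).
Proof.
apply: in_span_ext (in_spanD (in_spanZ (1 / 3) lapcube) (in_spanZ (- 2) fnrm)) _.
by move=> f sf x; rewrite lap_cube //; field.
Qed.

Lemma in_span_mul_grad_lap_grad : in_span (fun f x => f x * grad_lap_grad f x).
Proof.
apply: in_span_ext (in_spanD (in_spanZ (1 / 2) lapfnrm)
  (in_spanD (in_spanZ (- 1) fnh)
     (in_spanD (in_spanZ (- 2) hgg) (in_spanZ (- (1 / 2)) nlap)))) _.
move=> f sf x; rewrite lap_mul_normsq_grad //.
generalize (f x) (lap f x) (grad_lap_grad f x) (normsq_hess f x) (hess_grad_grad f x)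
  (normsq_grad f x) => f0 l c h q n.
by field.
Qed.

Lemma in_span_sqr_bilap : in_span (fun f x => f x ^+ 2 * bilap f x).
Proof.
apply: in_span_ext (in_spanD (in_spanZ (1 / 3) bilapcube)
  (in_spanD (in_spanZ (- 8) in_span_mul_grad_lap_grad)
     (in_spanD (in_spanZ (- 4) fnh)
       (in_spanD (in_spanZ (- 2) flap2)
         (in_spanD (in_spanZ (- 8) hgg) (in_spanZ (- 4) nlap)))))) _.
move=> f sf x; rewrite bilap_cube //.
generalize (f x) (lap f x) (bilap f x) (grad_lap_grad f x) (normsq_hess f x)
  (hess_grad_grad f x) (normsq_grad f x) => f0 l b c h q n.
by field.
Qed.

Lemma big_seq2 (I : Type) (G : I -> R) (i j : I) : \prod_(k <- [:: i; j]) G k = G i * G j.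
Proof. by rewrite !big_cons big_nil mulr1. Qed.

Lemma big_seq3 (I : Type) (G : I -> R) (i j k : I) :
  \prod_(l <- [:: i; j; k]) G l = G i * G j * G k.
Proof. by rewrite !big_cons big_nil mulr1 mulrA. Qed.

Lemma two_letter_sum_cons0 T f x :
  two_letter_sum ((0, 0)%N :: T) f x = f x * two_letter_sum T f x.
Proof.
rewrite mulr_sumr; apply: eq_bigr => a _; rewrite mulr_sumr; apply: eq_bigr => b _.
by rewrite big_cons.
Qed.

Lemma two_letter_sum_nil f x : two_letter_sum [::] f x = d%:R * d%:R.
Proof.
rewrite /two_letter_sum -[X in _ = _ * X]mulr1 -!ord_sum_const.
by do 2![apply: eq_bigr => ? _]; rewrite big_nil.
Qed.

Lemma two_letter_sum20 f x : two_letter_sum [:: (2, 0)%N] f x = d%:R * lap f x.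
Proof.
rewrite mulr_sumr; apply: eq_bigr => a _; rewrite -ord_sum_const.
by apply: eq_bigr => b _; rewrite big_seq1.
Qed.

Lemma two_letter_sum10_10 f x :
  two_letter_sum [:: (1, 0); (1, 0)]%N f x = d%:R * normsq_grad f x.
Proof.
rewrite normsq_gradE mulr_sumr; apply: eq_bigr => a _; rewrite -ord_sum_const.
by apply: eq_bigr => b _; rewrite big_seq2.
Qed.

Lemma two_letter_sum22 f x : smooth f ->
  two_letter_sum [:: (2, 2)%N] f x = bilap f x.
Proof.
move=> sf; rewrite /bilap [lap f]/lap lap_sum; last first.
  by move=> b; do 2!apply: smooth_partial.
rewrite [RHS]exchange_big; apply: eq_bigr => a _; apply: eq_bigr => b _.
by rewrite big_seq1.
Qed.

Lemma two_letter_sum12_10 f x : smooth f ->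
  two_letter_sum [:: (1, 2); (1, 0)]%N f x = grad_lap_grad f x.
Proof.
move=> sf; rewrite grad_lap_gradE; apply: eq_bigr => a _.
rewrite partial_sum; last by move=> b; do 2!apply: smooth_partial.
rewrite mulr_suml; apply: eq_bigr => b _.
by rewrite big_seq2.
Qed.

Lemma two_letter_sum11_11 f x :
  two_letter_sum [:: (1, 1); (1, 1)]%N f x = normsq_hess f x.
Proof.
rewrite normsq_hessE; apply: eq_bigr => a _; apply: eq_bigr => b _.
by rewrite big_seq2.
Qed.

Lemma two_letter_sum20_02 f x :
  two_letter_sum [:: (2, 0); (0, 2)]%N f x = lap f x ^+ 2.
Proof.
rewrite expr2 mulr_suml; apply: eq_bigr => a _; rewrite mulr_sumr.
by apply: eq_bigr => b _; rewrite big_seq2.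
Qed.

Lemma two_letter_sum11_10_01 f x :
  two_letter_sum [:: (1, 1); (1, 0); (0, 1)]%N f x = hess_grad_grad f x.
Proof.
rewrite hess_grad_gradE; apply: eq_bigr => a _; apply: eq_bigr => b _.
by rewrite big_seq3.
Qed.

Lemma two_letter_sum10_10_02 f x :
  two_letter_sum [:: (1, 0); (1, 0); (0, 2)]%N f x = normsq_grad f x * lap f x.
Proof.
rewrite normsq_gradE mulr_suml; apply: eq_bigr => a _; rewrite mulr_sumr.
by apply: eq_bigr => b _; rewrite big_seq3.
Qed.

(** The factors [d] and [d ^ 2] appear when one or both summation indices are
    absent from the double sum. *)
Lemma normal_bidegrees_in_span T : T \in normal_bidegrees ->
  in_span (two_letter_sum T).
Proof.
pose dd : R := d%:R * d%:R; pose d1 : R := d%:R.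
have E := (two_letter_sum_cons0, two_letter_sum_nil, two_letter_sum20,
  two_letter_sum10_10, two_letter_sum11_11, two_letter_sum20_02,
  two_letter_sum11_10_01, two_letter_sum10_10_02).
have E22 := two_letter_sum22; have E12 := two_letter_sum12_10.
rewrite /normal_bidegrees; do 20?[rewrite in_cons => /orP[/eqP -> |]]; last by rewrite in_nil.
- by apply: in_span_ext (in_spanZ dd one) _ => f sf x; rewrite !E mulr1.
- by apply: in_span_ext (in_spanZ dd id1) _ => f sf x; rewrite !E mulrC.
- by apply: in_span_ext (in_spanZ d1 lap1) _ => f sf x; rewrite !E.
- by apply: in_span_ext bilap1 _ => f sf x; rewrite E22.
- by apply: in_span_ext (in_spanZ dd id2) _ => f sf x; rewrite !E mulrA mulrC.
- by apply: in_span_ext (in_spanZ d1 in_span_mul_lap) _ => f sf x; rewrite !E mulrCA.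
- by apply: in_span_ext (in_spanZ d1 nrm) _ => f sf x; rewrite !E.
- by apply: in_span_ext in_span_mul_bilap _ => f sf x; rewrite !E E22.
- by apply: in_span_ext in_span_grad_lap_grad _ => f sf x; rewrite E12.
- by apply: in_span_ext nh _ => f sf x; rewrite !E.
- by apply: in_span_ext lap2 _ => f sf x; rewrite !E.
- by apply: in_span_ext (in_spanZ dd id3) _ => f sf x; rewrite !E /dd /d1; ring.
- apply: in_span_ext (in_spanZ d1 in_span_sqr_lap) _ => f sf x.
  by rewrite !E /dd /d1; ring.
- by apply: in_span_ext (in_spanZ d1 fnrm) _ => f sf x; rewrite !E mulrCA.
- by apply: in_span_ext in_span_sqr_bilap _ => f sf x; rewrite !E E22 // mulrA.
- by apply: in_span_ext in_span_mul_grad_lap_grad _ => f sf x; rewrite !E E12.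
- by apply: in_span_ext fnh _ => f sf x; rewrite !E.
- by apply: in_span_ext flap2 _ => f sf x; rewrite !E.
- by apply: in_span_ext hgg _ => f sf x; rewrite !E.
- by apply: in_span_ext nlap _ => f sf x; rewrite !E.
Qed.

Lemma pairing_sum_in_span sh q : q \in pairings -> size q = sumn sh ->
  (size sh <= 3)%N -> in_span (fun f x => pairing_sum q (word_mono sh f x)).
Proof.
move=> qP qs s3; have /hasP[T TN TP] := bidegrees_normal qP qs s3.
apply: in_span_ext (normal_bidegrees_in_span TN) _ => f sf x.
rewrite pairing_sum_bidegrees //; case/orP: TP; first exact: two_letter_sum_perm.
by rewrite -(two_letter_sum_swap _ _ sf); exact: two_letter_sum_perm.
Qed.

Lemma equivariant_in_span K : (2 <= d)%N -> polynomial_pdo 3 4 K -> equivariant K ->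
  in_span K.
Proof.
move=> d2 pK eK; have [l [hl El]] := equivariant_pairing_sums d2 eK pK.
apply: in_span_ext El; apply: in_span_sum => t /hl[qP qs s3].
exact: in_spanZ (pairing_sum_in_span qP qs s3).
Qed.

End LibrarySpan.

Lemma lib_MM_new (R : realType) (d : nat) (P : operator R d) :
  P \in lib_MM R d -> P \notin lib_M R d ->
  P \in [:: (fun f x => lap (fun y => f y ^+ 2) x) : operator R d;
            (fun f x => lap (normsq_grad f) x);
            (fun f x => bilap (fun y => f y ^+ 2) x);
            (fun f x => lap (fun y => f y ^+ 3) x);
            (fun f x => lap (fun y => f y * normsq_grad f y) x);
            (fun f x => bilap (fun y => f y ^+ 3) x)].
Proof.
move=> /tnthP[i ->]; pose z : operator R d := fun _ _ => 0.
have old : tnth (lib_M R d) i \in lib_M R d by exact: mem_tnth.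
move: old; rewrite !(tnth_nth z); case: i => m hm.
(* The two libraries agree position by position, except at the positions 5, 7, 8,
   12, 14 and 15; the selectors below count the goals that are still open. *)
do 20?[case: m hm => [|m] hm] => //=.
6: by move=> _ _; exact: (mem_nth z (s := [:: _; _; _; _; _; _]) (n := 0)).
7: by move=> _ _; exact: (mem_nth z (s := [:: _; _; _; _; _; _]) (n := 2)).
7: by move=> _ _; exact: (mem_nth z (s := [:: _; _; _; _; _; _]) (n := 1)).
10: by move=> _ _; exact: (mem_nth z (s := [:: _; _; _; _; _; _]) (n := 3)).
11: by move=> _ _; exact: (mem_nth z (s := [:: _; _; _; _; _; _]) (n := 5)).
11: by move=> _ _; exact: (mem_nth z (s := [:: _; _; _; _; _; _]) (n := 4)).
all: by move=> ->.
Qed.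

Theorem lemmaA1 (R : realType) (d : nat) (hd : (2 <= d)%N) :
  [/\ forall N : operator R d,
        polynomial_pdo 3 4 N -> equivariant N ->
        exists c : 'I_20 -> R, forall f : scalar_fun R d, smooth f ->
          forall x, N f x = \sum_(i < 20) c i * tnth (lib_MM R d) i f x,
      forall P : operator R d,
        P \in lib_MM R d -> P \notin lib_M R d ->
        P \in [:: (fun f x => lap (fun y => f y ^+ 2) x) : operator R d;
                  (fun f x => lap (normsq_grad f) x);
                  (fun f x => bilap (fun y => f y ^+ 2) x);
                  (fun f x => lap (fun y => f y ^+ 3) x);
                  (fun f x => lap (fun y => f y * normsq_grad f y) x);
                  (fun f x => bilap (fun y => f y ^+ 3) x)] &
      forall f : scalar_fun R d, smooth f -> forall x,
        [/\ lap (fun y => f y ^+ 2) x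
              = 2 * (f x * lap f x) + 2 * normsq_grad f x,
            lap (normsq_grad f) x
              = 2 * grad_lap_grad f x + 2 * normsq_hess f x &
            bilap (fun y => f y ^+ 2) x
              = 2 * (f x * bilap f x) + 8 * grad_lap_grad f x
                + 4 * normsq_hess f x + 2 * lap f x ^+ 2]
        /\
        [/\ lap (fun y => f y ^+ 3) x
              = 3 * (f x ^+ 2 * lap f x) + 6 * (f x * normsq_grad f x),
            lap (fun y => f y * normsq_grad f y) x
              = 2 * (f x * grad_lap_grad f x) + 2 * (f x * normsq_hess f x)
                + 4 * hess_grad_grad f x + normsq_grad f x * lap f x &
            bilap (fun y => f y ^+ 3) x
              = 3 * (f x ^+ 2 * bilap f x) + 24 * (f x * grad_lap_grad f x)
                + 12 * (f x * normsq_hess f x) + 6 * (f x * lap f x ^+ 2)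
                + 24 * hess_grad_grad f x
                + 12 * (normsq_grad f x * lap f x)]].
Proof.
split=> [N pN eN|P|f sf x]; first exact: equivariant_in_span.
  exact: lib_MM_new.
by rewrite lap_square // lap_normsq_grad // bilap_square // lap_cube //
  lap_mul_normsq_grad // bilap_cube.
Qed.
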